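(* Let $J>0$, $h\ne0$, $\rho>0$ and $\varepsilon\in\mathcal{E}_{h,\rho}$. Define $m=-\frac hJ+\mathrm{sgn}(h)\sqrt{\frac{h^2}{J^2}-\frac{2\varepsilon}J}$, $\mu=-\frac m{\rho-m^2}$ and $\eta=\frac1{2(\rho-m^2)}$. Let $I\subset\Lambda$ be an index set of fixed size, and let $f:\mathbb{R}^{|I|}\to\mathbb{R}$ be either a bounded $1$-Lipschitz function with respect to $\|\cdot\|_2$ or a finite product of coordinates of finite order. Then \[ \langle f\circ P_I\rangle_{\mathrm{MC}}^{\varepsilon,\rho;N}=\langle f\circ P_I\rangle_{\mathrm{GC}}^{\mu,\eta;N}+O(N^{-1/2}). \]
   Context: Mean-field spherical model: $\Lambda$ finite lattice, $N=|\Lambda|$, $\phi\in\mathbb{R}^N$, $H[\phi]=-\frac J{2N}(\sum_x\phi_x)^2-h\sum_x\phi_x$; $P_I$ restricts to sites in $I$. For $|m|<\sqrt\rho$, $\mu_{\mathrm{MC}}^{m,\rho;N}$ is the normalized uniform surface measure on $\{\sum\phi_x=mN,\ \sum\phi_x^2=\rho N\}$, $Z_{\mathrm{MC}}(m,\rho;N)=(\rho-m^2)^{(N-3)/2}$. For $\varepsilon\le\frac{h^2}{2J}$, $m_\pm=-\frac hJ\pm\sqrt{\frac{h^2}{J^2}-\frac{2\varepsilon}J}$. Fixed energy ensemble: if $\varepsilon<\frac{h^2}{2J}$ and $m_\pm^2<\rho$, $\langle f\rangle_{\mathrm{MC}}^{\varepsilon,\rho;N}=\sum_\pm\frac{Z_{\mathrm{MC}}(m_\pm,\rho;N)}{Z_{\mathrm{MC}}(m_+,\rho;N)+Z_{\mathrm{MC}}(m_-,\rho;N)}\langle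 f\rangle_{\mathrm{MC}}^{m_\pm,\rho;N}$; if $\varepsilon<\frac{h^2}{2J}$ and $\min(m_\pm^2)<\rho\le\max(m_\pm^2)$, it is $\langle f\rangle_{\mathrm{MC}}^{m',\rho;N}$ with $m'$ the one of $m_\pm$ of smaller absolute value; if $\varepsilon=\frac{h^2}{2J}$ and $\rho>h^2/J^2$, it is $\langle f\rangle_{\mathrm{MC}}^{-h/J,\rho;N}$. $\mathcal{E}_{h,\rho}=\{\varepsilon\le\frac{h^2}{2J}:|\frac{|h|}J-\sqrt{\frac{h^2}{J^2}-\frac{2\varepsilon}J}|<\sqrt\rho\}$. $\mu_{\mathrm{GC}}^{\mu,\eta;N}$ has density on $\mathbb{R}^N$ proportional to $e^{-\mu\sum_x\phi_x-\eta\sum_x\phi_x^2}$. *)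

(* Defs.v *)
From HB Require Import structures.
From mathcomp Require Import all_boot all_order all_algebra.
From mathcomp Require Import all_classical all_reals all_analysis.
Set Implicit Arguments. Unset Strict Implicit. Unset Printing Implicit Defensive.
Import Order.TTheory GRing.Theory Num.Theory.
Import numFieldNormedType.Exports.
Local Open Scope classical_set_scope.
Local Open Scope ring_scope.

Section Defs.
Variable R : realType.

(* Spin configurations phi in R^N are represented as sequences of length N;
   the site x of Lambda = {0,..,N-1} carries the spin phi`_x. *)

(* Lebesgue integral over R^n, written as the iterated one-dimensional
   Lebesgue integral (Fubini):
   iint n g = \int dx_0 ... \int dx_{n-1} g [:: x_0; ...; x_{n-1}]. *)
Fixpoint iint (n : nat) (g : seq R -> R) : R :=
  match n with
  | 0 => g [::]
  | n'.+1 => Rintegral (@lebesgue_measure R) setT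
               (fun x : R => iint n' (fun s => g (x :: s)))
  end.

Definition ssum (phi : seq R) : R := \sum_(x <- phi) x.
Definition ssumsq (phi : seq R) : R := \sum_(x <- phi) x ^+ 2.

Definition gc_weight (mu eta : R) (phi : seq R) : R :=
  expR (- mu * ssum phi - eta * ssumsq phi).

Definition gc_avg (mu eta : R) (N : nat) (g : seq R -> R) : R :=
  iint N (fun phi => g phi * gc_weight mu eta phi) / iint N (gc_weight mu eta).

(* Microcanonical expectation with fixed magnetisation m and fixed
   sum of squares rho: normalised uniform surface measure on
   {sum phi = m N, sum phi^2 = rho N}, obtained as the delta-function limit
   of Lebesgue measure restricted to the shell
   {|sum phi - m N| < d, |sum phi^2 - rho N| < d}, d -> 0+. *)
Definition shell (m rho : R) (N : nat) (d : R) (phi : seq R) : R :=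
  if (`|ssum phi - m * N%:R| < d) && (`|ssumsq phi - rho * N%:R| < d)
  then 1 else 0.

Definition mc_avg (m rho : R) (N : nat) (g : seq R -> R) : R :=
  lim ((fun d : R => iint N (fun phi => g phi * shell m rho N d phi)
                     / iint N (shell m rho N d)) @ 0^'+).

Definition Z_MC (m rho : R) (N : nat) : R :=
  powR (rho - m ^+ 2) ((N%:R - 3) / 2).

Definition m_plus (J h eps : R) : R :=
  - (h / J) + Num.sqrt (h ^+ 2 / J ^+ 2 - 2 * eps / J).
Definition m_minus (J h eps : R) : R :=
  - (h / J) - Num.sqrt (h ^+ 2 / J ^+ 2 - 2 * eps / J).

(* Fixed energy ensemble (the three cases of the definition; outside of
   E_{h,rho} the value is irrelevant). *)
Definition fe_avg (J h eps rho : R) (N : nat) (g : seq R -> R) : R :=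
  let mp := m_plus J h eps in
  let mm := m_minus J h eps in
  if eps < h ^+ 2 / (2 * J) then
    if (mp ^+ 2 < rho) && (mm ^+ 2 < rho) then
      (Z_MC mp rho N * mc_avg mp rho N g + Z_MC mm rho N * mc_avg mm rho N g)
        / (Z_MC mp rho N + Z_MC mm rho N)
    else if `|mp| < `|mm| then mc_avg mp rho N g else mc_avg mm rho N g
  else mc_avg (- (h / J)) rho N g.

Definition admissible_energy (J h rho eps : R) : Prop :=
  eps <= h ^+ 2 / (2 * J) /\
  `| `|h| / J - Num.sqrt (h ^+ 2 / J ^+ 2 - 2 * eps / J) | < Num.sqrt rho.

Definition restr (k N : nat) (I : 'I_k -> 'I_N) (phi : seq R) : 'I_k -> R :=
  fun j => phi`_(I j).

Definition bounded_1lipschitz (k : nat) (f : ('I_k -> R) -> R) : Prop :=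
  (exists B : R, forall x, `|f x| <= B) /\
  (forall x y, `|f x - f y| <= Num.sqrt (\sum_(j < k) (x j - y j) ^+ 2)).

Definition coord_monomial (k : nat) (f : ('I_k -> R) -> R) : Prop :=
  exists a : 'I_k -> nat, forall x, f x = \prod_(j < k) x j ^+ a j.

End Defs.

(* Main.v *)
(* Given the k spins y at the sites of I, the others lie on a sphere of squared radius
   D(y) = rho N - |y|^2 - (m N - sum y)^2 / n, n = N - k, so the k-site marginal of the
   microcanonical measure has density proportional to D(y)_+^((n-3)/2). The shells defining
   the measure are handled through the exact volume of {a < sum phi < b, |phi|^2 < r} in R^n,
   namely c_n \int_a^b (r - s^2/n)_+^((n-1)/2) ds, obtained one coordinate at a time.
   Centering y at m turns D(y) into (rho - m^2) N - |z|^2 - (sum z)^2 / n, hence the density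
   is within O(1/N) of the Gaussian one, with a Gaussian error profile; this works for every
   observable of subgaussian growth. When both m_+ and m_- are allowed, the one of larger
   modulus has exponentially small weight. *)

Require Import Defs.
From mathcomp Require Import all_boot all_order all_algebra.
From mathcomp Require Import all_classical all_reals all_analysis.
From mathcomp Require Import measurable_realfun zify ring lra.
Set Implicit Arguments. Unset Strict Implicit. Unset Printing Implicit Defensive.
Import Order.TTheory GRing.Theory Num.Theory.
Import numFieldNormedType.Exports.
Local Open Scope classical_set_scope.
Local Open Scope ring_scope.

(** * One-dimensional Lebesgue integrals *)

Section Lebesgue1D.
Context {R : realType}.
Notation mu := (@lebesgue_measure R).

(** [iint] iterates an integral that falls back to a default value on non-integrable functions, and
    sequences carry no sigma-algebra. Fubini, linearity and monotonicity are therefore confined to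
    the class [nice]: coordinatewise measurable functions with a Gaussian bound. It contains the
    shell indicators, the Gaussian weights and their products with the observables, and it is stable
    under freezing, permuting and integrating out coordinates. The shell limit needs neither
    differentiation nor dominated convergence. The volume formula, of exponent [(n-1)/2], is
    differenced by mean value inequalities; this traps the shell volume between
    [c d^2 sqrt(D - lam d)^(n-3)] and [c d^2 sqrt(D + lam d)^(n-3)], so after division by [c d^2]
    the error is linear in [d], uniformly in [y]. The constant [c] is never computed, because it
    cancels between numerator and denominator. By permutation symmetry neither average depends on
    [I], and the grand-canonical one does not depend on [N] either: that single number is the
    reference value. The rate obtained is [1/N], relaxed to [N^(-1/2)] only in the theorem. *)

Definition affine (l a : R) : measurableTypeR R -> measurableTypeR R :=
  fun x => l * x + a.

Lemma measurable_affine (l a : R) : measurable_fun setT (affine l a).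
Proof. by apply: measurable_funD => //; apply: measurable_funM. Qed.

Definition affine_image (l a : R) : {measure set (measurableTypeR R) -> \bar R}.
Proof. by refine (pushforward mu (affine l a)); exact: measurable_affine. Defined.

(** The preimage of []c, d]] has length [(d - c) / l], so the scaled image measure agrees with
    length on intervals; uniqueness of Lebesgue measure does the rest. *)
Lemma lebesgue_affine (l a : R) (l0 : 0 < l) (A : set (measurableTypeR R)) :
  measurable A -> mu A = mscale (NngNum (ltW l0)) (affine_image l a) A.
Proof.
move=> mA.
apply: (@lebesgue_measure_unique R (mscale (NngNum (ltW l0)) (affine_image l a))) => //.
move=> X [[c d] _ <-] /=; rewrite /mscale /= /affine_image /pushforward /=.
rewrite [affine l a @^-1` _](_ : _ = `](c - a) / l, (d - a) / l]%classic); last first.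
  by apply/seteqP; split => x /=; rewrite /affine !in_itv /= ltr_pdivrMr // ler_pdivlMr //
    ltrBlDr lerBrDr mulrC.
rewrite !lebesgue_measure_itv /= !lte_fin ltr_pM2r ?invr_gt0 // ltrD2r.
case: ifP => // _; last by rewrite mule0.
rewrite -!EFinB -EFinM; congr (_%:E); field; exact: lt0r_neq0.
Qed.

Lemma ge0_integral_affine (l a : R) (u : R -> R) : 0 < l -> measurable_fun setT u ->
  (forall x, 0 <= u x) ->
  (\int[mu]_x (u x)%:E = l%:E * \int[mu]_x (u (l * x + a))%:E)%E.
Proof.
move=> l0 mu' u0.
have mE : measurable_fun setT (EFin \o u) by exact/measurable_EFinP.
have mphi := measurable_affine l a.
rewrite (eq_measure_integral _ (fun A mA _ => @lebesgue_affine l a l0 A mA)) //.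
rewrite ge0_integral_mscale //=; last by move=> x _; rewrite lee_fin.
by rewrite (ge0_integral_pushforward (measurable_affine l a)) // => x _; rewrite lee_fin.
Qed.

(** Positive and negative parts scale separately in the extended reals. A factor [l > 0] keeps
    infinite parts infinite, so [fine] takes the same default on both sides and non-integrable [u]
    are covered. *)
Lemma Rintegral_affine (l a : R) (u : R -> R) : 0 < l -> measurable_fun setT u ->
  \int[mu]_x u x = l * \int[mu]_x u (l * x + a).
Proof.
move=> l0 mu'.
have E (v : R -> R) : measurable_fun setT v -> \int[mu]_x v x =
    fine (\int[mu]_x (v^\+ x)%:E - \int[mu]_x (v^\- x)%:E)%E.
  move=> mv; rewrite /Rintegral integralE; congr fine; congr (_ - _)%E;
  apply: eq_integral => x _.
    by rewrite funeposE /= /funrpos /= EFin_max.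
  by rewrite funenegE /= /funrneg /= EFin_max.
have mv : measurable_fun setT (fun x => u (l * x + a)).
  by exact: measurableT_comp mu' (measurable_affine l a).
rewrite E // E // (@ge0_integral_affine l a u^\+) //; last first.
  exact: measurable_funrpos.
rewrite (@ge0_integral_affine l a u^\-) //; last exact: measurable_funrneg.
rewrite -[l in RHS]/(fine l%:E).
case: (\int[mu]_x _)%E => [p| |]; case: (\int[mu]_x _)%E => [q| |] //=;
  rewrite ?gt0_muley ?lte_fin ?gt0_muleNy ?lte_fin //= ?mulr0 //.
by rewrite mulrBr.
Qed.

Lemma Rintegral_translate (a : R) (u : R -> R) : measurable_fun setT u ->
  \int[mu]_x u (x + a) = \int[mu]_x u x.
Proof.
move=> mu'; rewrite (@Rintegral_affine 1 a u) // mul1r.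
by under [RHS]eq_Rintegral do rewrite mul1r.
Qed.

Lemma Rintegral_dilate (l : R) (u : R -> R) : 0 < l -> measurable_fun setT u ->
  \int[mu]_x u (l * x) = l^-1 * \int[mu]_x u x.
Proof.
move=> l0 mu'; rewrite (@Rintegral_affine l 0 u) // mulrA mulVf ?lt0r_neq0 // mul1r.
by under [RHS]eq_Rintegral do rewrite addr0.
Qed.

Lemma measurable_expNsqr (c : R) : measurable_fun setT (fun x : R => expR (- c * x ^+ 2)).
Proof. by apply: measurableT_comp => //; apply: measurable_funM. Qed.

Lemma integrable_expNsqr (c : R) : 0 < c ->
  mu.-integrable setT (fun x => (expR (- c * x ^+ 2))%:E).
Proof.
move=> c0; apply/integrableP; split.
  by apply/measurable_EFinP; exact: measurable_expNsqr.
under eq_integral do rewrite /= ger0_norm ?expR_ge0 //.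
have s0 : 0 < Num.sqrt c by rewrite sqrtr_gt0.
have := @ge0_integral_affine (Num.sqrt c) 0 gauss_fun s0 measurable_gauss_fun
  gauss_fun_ge0.
rewrite integralT_gauss.
have -> : (\int[mu]_x (gauss_fun (Num.sqrt c * x + 0))%:E =
    \int[mu]_x (expR (- c * x ^+ 2))%:E)%E.
  apply: eq_integral => x _.
  by rewrite addr0 /gauss_fun exprMn sqr_sqrtr ?ltW // mulNr.
case: (\int[mu]_x _)%E => [r| |] //.
  by rewrite ltry.
by rewrite gt0_muley ?lte_fin.
Qed.

Lemma gauss_dominated_integrable (C c : R) (u : R -> R) : 0 < c -> measurable_fun setT u ->
  (forall x, `|u x| <= C * expR (- c * x ^+ 2)) ->
  mu.-integrable setT (EFin \o u).
Proof.
move=> c0 mu' le.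
apply: (@le_integrable _ _ _ mu _ measurableT (EFin \o u)
  (fun x => (C * expR (- c * x ^+ 2))%:E)) => //.
- exact/measurable_EFinP.
- by move=> x _ /=; rewrite lee_fin (le_trans (le x)) // ler_norm.
under eq_fun do rewrite EFinM.
by apply: integrableZl => //; exact: integrable_expNsqr.
Qed.

Lemma measurable_Rintegral d (T : measurableType d) (u : T -> R -> R) :
  measurable_fun setT (fun p : T * R => u p.1 p.2) ->
  measurable_fun setT (fun t => \int[mu]_x u t x).
Proof.
move=> mu'; rewrite /Rintegral.
pose v (p : T * R) := (u p.1 p.2)%:E.
have mv : measurable_fun setT v by exact/measurable_EFinP.
have hP : measurable_fun setT (fubini_F mu v^\+%E).
  by apply: measurable_fun_fubini_tonelli_F => //; exact: measurable_funepos.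
have hN : measurable_fun setT (fubini_F mu v^\-%E).
  by apply: measurable_fun_fubini_tonelli_F => //; exact: measurable_funeneg.
have := emeasurable_funB hP hN.
have -> : (fun t => fubini_F mu v^\+ t - fubini_F mu v^\- t)%E =
   (fun t => \int[mu]_x (u t x)%:E)%E.
  apply/funext => t; rewrite [RHS]integralE /fubini_F.
  by congr (_ - _)%E; apply: eq_integral => x _; rewrite ?funeposE ?funenegE.
by move=> h; apply: measurableT_comp h; exact: fine_measurable.
Qed.

Lemma gauss_dominated_integrable2 (C c : R) (u : R -> R -> R) : 0 < c ->
  measurable_fun setT (fun p : R * R => u p.1 p.2) ->
  (forall x y, `|u x y| <= C * (expR (- c * x ^+ 2) * expR (- c * y ^+ 2))) ->
  (forall x, mu.-integrable setT (EFin \o u x)) /\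
  (mu \x mu)%E.-integrable setT (EFin \o (fun p : R * R => u p.1 p.2)).
Proof.
move=> c0 mu' le.
have mu1 x : measurable_fun setT (u x).
  by apply: (measurableT_comp mu' (measurable_pair1 x)).
have C0 : 0 <= C.
  have := le 0 0; rewrite expr0n /= mulr0 expR0 !mulr1; exact: le_trans.
split=> [x|].
  by apply: (@gauss_dominated_integrable (C * expR (- c * x ^+ 2)) c) => // y;
    rewrite -mulrA.
apply/integrable12ltyP; first exact/measurable_EFinP.
have [K HK] : exists K : R, (\int[mu]_y (expR (- c * y ^+ 2))%:E)%E = K%:E.
  by exists (fine (\int[mu]_y (expR (- c * y ^+ 2))%:E)%E); rewrite fineK //;
    apply: integrable_fin_num => //; exact: integrable_expNsqr.
apply: (@le_lt_trans _ _ (\int[mu]_x (C * K * expR (- c * x ^+ 2))%:E)%E).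
  apply: ge0_le_integral => //=.
  - by move=> x _; exact: integral_ge0.
  - suff h : measurable_fun setT (fubini_F mu (fun p : R * R => `|(u p.1 p.2)%:E|%E)) by exact: h.
    apply: measurable_fun_fubini_tonelli_F => //.
    by apply: measurableT_comp => //; exact/measurable_EFinP.
  - by apply/measurable_EFinP; apply: measurable_funM => //; exact: measurable_expNsqr.
  move=> x _.
  have -> : (C * K * expR (- c * x ^+ 2))%:E =
     (\int[mu]_y ((C * expR (- c * x ^+ 2))%:E * (expR (- c * y ^+ 2))%:E))%E.
    rewrite integralZl //; last exact: integrable_expNsqr.
    by rewrite HK -EFinM mulrAC.
  apply: ge0_le_integral => //=.
  - by apply/measurable_EFinP; apply: measurableT_comp => //; exact: mu1.
  - by apply/measurable_EFinP; apply: measurable_funM => //; exact: measurable_expNsqr.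
  - by move=> y _; rewrite lee_fin -mulrA.
under eq_integral do rewrite EFinM.
rewrite integralZl //; last exact: integrable_expNsqr.
by rewrite HK -EFinM ltry.
Qed.

Lemma gauss_section_integrable (C c : R) (u : R -> R -> R) : 0 < c ->
  measurable_fun setT (fun p : R * R => u p.1 p.2) ->
  (forall x y, `|u x y| <= C * (expR (- c * x ^+ 2) * expR (- c * y ^+ 2))) ->
  mu.-integrable setT (EFin \o (fun x => \int[mu]_y u x y)).
Proof.
move=> c0 mu' le; have [i1 ii] := gauss_dominated_integrable2 c0 mu' le.
apply: eq_integrable (integrable_fubini_F ii) => // x _.
rewrite /fubini_F /= /Rintegral fineK //; exact: integrable_fin_num (i1 x).
Qed.

(** A product Gaussian bound gives integrability on the plane and on every section, so the real
    inner integrals coincide with the extended ones in Fubini. *)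
Lemma Rintegral_swap (C c : R) (u : R -> R -> R) : 0 < c ->
  measurable_fun setT (fun p : R * R => u p.1 p.2) ->
  (forall x y, `|u x y| <= C * (expR (- c * x ^+ 2) * expR (- c * y ^+ 2))) ->
  \int[mu]_x \int[mu]_y u x y = \int[mu]_y \int[mu]_x u x y.
Proof.
move=> c0 mu' le; have [i1 ii] := gauss_dominated_integrable2 c0 mu' le.
have mu2 : measurable_fun setT (fun p : R * R => u p.2 p.1).
  have ms : measurable_fun setT (fun p : R * R => (p.2, p.1)) by exact: measurable_fun_pair.
  exact: (measurableT_comp mu' ms).
have le2 y x : `|u x y| <= C * (expR (- c * y ^+ 2) * expR (- c * x ^+ 2)).
  by rewrite [expR _ * expR _]mulrC.
have [i2 _] := gauss_dominated_integrable2 c0 mu2 le2.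
have := Fubini ii; rewrite /=.
have -> : (\int[mu]_x \int[mu]_y (u x y)%:E = \int[mu]_x (\int[mu]_y u x y)%:E)%E.
  by apply: eq_integral => x _; rewrite /Rintegral fineK //; exact: integrable_fin_num (i1 x).
have -> : (\int[mu]_y \int[mu]_x (u x y)%:E = \int[mu]_y (\int[mu]_x u x y)%:E)%E.
  by apply: eq_integral => y _; rewrite /Rintegral fineK //; exact: integrable_fin_num (i2 y).
by move/(congr1 fine).
Qed.

End Lebesgue1D.

(** * Iterated integrals of functions with Gaussian decay *)

Section IteratedIntegral.
Context {R : realType}.
Notation mu := (@lebesgue_measure R).
Implicit Types (n : nat) (g : seq R -> R) (phi psi : seq R).

Lemma ssum_cons (x : R) phi : ssum (x :: phi) = x + ssum phi.
Proof. by rewrite /ssum big_cons. Qed.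

Lemma ssumsq_cons (x : R) phi : ssumsq (x :: phi) = x ^+ 2 + ssumsq phi.
Proof. by rewrite /ssumsq big_cons. Qed.

Lemma ssum_cat phi psi : ssum (phi ++ psi) = ssum phi + ssum psi.
Proof. by rewrite /ssum big_cat. Qed.

Lemma ssumsq_cat phi psi : ssumsq (phi ++ psi) = ssumsq phi + ssumsq psi.
Proof. by rewrite /ssumsq big_cat. Qed.

Lemma ssumsq_ge0 phi : 0 <= ssumsq phi.
Proof. by rewrite /ssumsq sumr_ge0 // => i _; rewrite sqr_ge0. Qed.

Lemma perm_ssum phi psi : perm_eq phi psi -> ssum phi = ssum psi.
Proof. exact: perm_big. Qed.

Lemma perm_ssumsq phi psi : perm_eq phi psi -> ssumsq phi = ssumsq psi.
Proof. exact: perm_big. Qed.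

Definition measurable_family n d (T : measurableType d) (X : T -> seq R) : Prop :=
  (forall t, size (X t) = n) /\
  (forall i, measurable_fun setT (fun t => (X t)`_i)).

(* Borel measurability on R^n, phrased without a sigma-algebra on sequences:
   composing with measurable coordinates gives a measurable function. *)
Definition seq_measurable n g : Prop :=
  forall d (T : measurableType d) (X : T -> seq R),
    measurable_family n X -> measurable_fun setT (fun t => g (X t)).

(** The rate [c] is existential, so that it may shrink in sums and in products with growing
    observables. *)
Definition gauss_bounded n g : Prop :=
  exists C c : R, [/\ 0 <= C, 0 < c &
    forall phi, size phi = n -> `|g phi| <= C * expR (- c * ssumsq phi)].

Definition nice n g : Prop := seq_measurable n g /\ gauss_bounded n g.

Lemma family_cons n d (T : measurableType d) (x : T -> R) (X : T -> seq R) :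
  measurable_fun setT x -> measurable_family n X ->
  measurable_family n.+1 (fun t => x t :: X t).
Proof.
by move=> mx [sX mX]; split=> [t|[|i]] //=; rewrite sX.
Qed.

Lemma family_map n (p : seq nat) d (T : measurableType d) (X : T -> seq R) :
  measurable_family n X -> measurable_family (size p) (fun t => [seq (X t)`_i | i <- p]).
Proof.
move=> [sX mX]; split=> [t|i]; first by rewrite size_map.
have [ip|ip] := ltnP i (size p).
  by under eq_fun do rewrite (nth_map 0%N) //; exact: mX.
by under eq_fun do rewrite nth_default ?size_map //; exact: measurable_cst.
Qed.

Lemma family_ssum n d (T : measurableType d) (X : T -> seq R) :
  measurable_family n X -> measurable_fun setT (fun t => ssum (X t)).
Proof.
move=> [sX mX]; rewrite /ssum.
under eq_fun do rewrite (big_nth 0) big_mkord sX.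
by apply: measurable_sum => i.
Qed.

Lemma family_ssumsq n d (T : measurableType d) (X : T -> seq R) :
  measurable_family n X -> measurable_fun setT (fun t => ssumsq (X t)).
Proof.
move=> [sX mX]; rewrite /ssumsq.
under eq_fun do rewrite (big_nth 0) big_mkord sX.
by apply: measurable_sum => i; apply: measurable_funX.
Qed.

Lemma seq_measurable_ext n g g' : (forall phi, size phi = n -> g phi = g' phi) ->
  seq_measurable n g -> seq_measurable n g'.
Proof.
move=> e mg d T X mX; have := mg d T X mX.
by have -> : (fun t => g (X t)) = (fun t => g' (X t)) by
  apply/funext => t; apply: e; case: mX.
Qed.

Lemma nice_ext n g g' : (forall phi, size phi = n -> g phi = g' phi) ->
  nice n g -> nice n g'.
Proof.
move=> e [mg [C [c [C0 c0 le]]]]; split; first exact: seq_measurable_ext mg.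
by exists C, c; split => // phi s; rewrite -e // le.
Qed.

(** Common principle behind freezing and permuting coordinates: a Gaussian bound survives any
    substitution that does not decrease the sum of squares. *)
Lemma nice_pull n n' (r : seq R -> seq R) g :
  (forall d (T : measurableType d) (X : T -> seq R),
     measurable_family n X -> measurable_family n' (fun t => r (X t))) ->
  (forall phi, size phi = n -> size (r phi) = n') ->
  (forall phi, size phi = n -> ssumsq phi <= ssumsq (r phi)) ->
  nice n' g -> nice n (fun phi => g (r phi)).
Proof.
move=> mr sr qr [mg [C [c [C0 c0 le]]]]; split.
  by move=> d T X mX; exact: mg (mr _ _ _ mX).
exists C, c; split => // phi s; apply: (le_trans (le _ (sr _ s))).
by rewrite ler_wpM2l // ler_expR !mulNr lerN2 ler_wpM2l ?qr // ltW.
Qed.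

Lemma nice_cons n g x : nice n.+1 g -> nice n (fun phi => g (x :: phi)).
Proof.
apply: nice_pull => [d T X mX|phi /= ->|phi _] //.
  by apply: family_cons.
by rewrite ssumsq_cons lerDr sqr_ge0.
Qed.

Lemma map_nth_iota n phi : size phi = n -> [seq phi`_i | i <- iota 0 n] = phi.
Proof. by move=> <-; exact: mkseq_nth. Qed.

Lemma perm_map_nth n (p : seq nat) phi : size phi = n -> perm_eq p (iota 0 n) ->
  perm_eq [seq phi`_i | i <- p] phi.
Proof. by move=> s pp; rewrite -[X in perm_eq _ X](map_nth_iota s) perm_map. Qed.

Lemma nice_perm n (p : seq nat) g : perm_eq p (iota 0 n) ->
  nice n g -> nice n (fun phi => g [seq phi`_i | i <- p]).
Proof.
move=> pp; have sp : size p = n by rewrite (perm_size pp) size_iota.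
apply: nice_pull => [d T X mX|phi _|phi s].
- by rewrite -sp; exact: family_map mX.
- by rewrite size_map.
- by rewrite (perm_ssumsq (perm_map_nth s pp)).
Qed.

(** [nice_Rintegral] integrates the head variable only; this rotation lets [nice_iint] integrate the
    last variable of a prefix. *)
Lemma nice_rcons n g : nice n.+1 g -> nice n.+1 (fun s => g (rcons (behead s) (head 0 s))).
Proof.
move=> ng; apply: (@nice_ext _ (fun phi => g [seq phi`_i | i <- rot 1 (iota 0 n.+1)])).
  by move=> [//|x s] [sn]; rewrite map_rot map_nth_iota /= ?sn // rot1_cons.
by apply: nice_perm => //; rewrite perm_rot.
Qed.

Lemma nice_Rintegral n g : nice n.+1 g -> nice n (fun phi => \int[mu]_x g (x :: phi)).
Proof.
move=> [mg [C [c [C0 c0 le]]]]; split.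
  move=> d T X [sX mX]; apply: (@measurable_Rintegral _ _ _ (fun t x => g (x :: X t))).
  apply: (mg _ _ (fun p : T * R => p.2 :: X p.1)); apply: family_cons => //.
  by split=> [t|i] //; exact: measurableT_comp (mX i) _.
exists (C * \int[mu]_x expR (- c * x ^+ 2)), c; split => //.
  by rewrite mulr_ge0 // Rintegral_ge0 // => x _; exact: expR_ge0.
move=> phi s.
have le' x : `|g (x :: phi)| <= C * expR (- c * ssumsq phi) * expR (- c * x ^+ 2).
  by rewrite -mulrA -expRD -mulrDr addrC -ssumsq_cons le //= s.
have mgx : measurable_fun setT (fun x => g (x :: phi)).
  by apply: mg; apply: family_cons => //; split => // i; exact: measurable_cst.
have ig : mu.-integrable setT (EFin \o (fun x => g (x :: phi))).
  exact: gauss_dominated_integrable le'.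
apply: (le_trans (le_normr_Rintegral measurableT ig)).
rewrite mulrAC -RintegralZl //; last exact: integrable_expNsqr.
apply: le_Rintegral => //.
- apply: (@gauss_dominated_integrable _ (C * expR (- c * ssumsq phi)) c) => //.
    exact: measurableT_comp.
  by move=> x; rewrite normr_id.
- by apply: (@gauss_dominated_integrable _ (C * expR (- c * ssumsq phi)) c) => [//||x];
    [apply: measurable_funM => //; exact: measurable_expNsqr
    |rewrite ger0_norm // !mulr_ge0 ?expR_ge0].
Qed.

Lemma iint_ext n g g' : (forall phi, size phi = n -> g phi = g' phi) ->
  iint n g = iint n g'.
Proof.
elim: n g g' => [|n ih] g g' e /=; first exact: e.
by apply: eq_Rintegral => x _; apply: ih => phi s; apply: e; rewrite /= s.
Qed.

Lemma iintS n g : iint n.+1 g = \int[mu]_x iint n (fun phi => g (x :: phi)).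
Proof. by []. Qed.

Lemma nice_iint j n g : nice (j + n) g -> nice j (fun phi => iint n (fun psi => g (phi ++ psi))).
Proof.
elim: n j g => [|n ih] j g; rewrite ?addn0 => ng /=.
  by apply: nice_ext ng => phi _; rewrite cats0.
rewrite -addSnnS in ng; have /nice_rcons /nice_Rintegral := ih _ _ ng.
apply: nice_ext => phi s /=; apply: eq_Rintegral => x _; apply: iint_ext => psi _.
by rewrite cat_rcons.
Qed.

Lemma nice_section n g : nice n.+1 g ->
  exists C c : R, [/\ 0 <= C, 0 < c, measurable_fun setT (fun x => iint n (fun phi => g (x :: phi))) &
    forall x, `|iint n (fun phi => g (x :: phi))| <= C * expR (- c * x ^+ 2)].
Proof.
rewrite -add1n => /nice_iint [mg [C [c [C0 c0 le]]]].
exists C, c; split => //.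
  by apply: (mg _ _ (fun x : R => [:: x])); apply: (@family_cons 0 _ _ id (fun=> [::])).
by move=> x; have := le [:: x] erefl; rewrite /ssumsq big_seq1; apply.
Qed.

Lemma nice_section_integrable n g : nice n.+1 g ->
  mu.-integrable setT (EFin \o (fun x => iint n (fun phi => g (x :: phi)))).
Proof.
move=> /nice_section[C [c [C0 c0 m le]]]; exact: gauss_dominated_integrable le.
Qed.

Lemma niceM_bounded n g h : seq_measurable n h ->
  (exists B : R, forall phi, size phi = n -> `|h phi| <= B) ->
  nice n g -> nice n (fun phi => h phi * g phi).
Proof.
move=> mh [B le] [mg [C [c [C0 c0 leg]]]]; split.
  by move=> d T X mX; apply: measurable_funM; [exact: mh|exact: mg].
have B0 : 0 <= B by apply: le_trans (le (nseq n 0) (size_nseq _ _)).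
exists (B * C), c; split => //; first exact: mulr_ge0.
by move=> phi s; rewrite normrM -mulrA ler_pM // ?le // leg.
Qed.

Lemma seq_measurable_cst n (a : R) : seq_measurable n (fun=> a).
Proof. by move=> d T X _; exact: measurable_cst. Qed.

Lemma niceZ n (a : R) g : nice n g -> nice n (fun phi => a * g phi).
Proof.
apply: niceM_bounded; first exact: seq_measurable_cst.
by exists `|a|.
Qed.

Lemma niceD n g h : nice n g -> nice n h -> nice n (fun phi => g phi + h phi).
Proof.
move=> [mg [C [c [C0 c0 leg]]]] [mh [D [d [D0 d0 leh]]]]; split.
  by move=> ? T X mX; apply: measurable_funD; [exact: mg|exact: mh].
exists (C + D), (Num.min c d); split; [exact: addr_ge0|by rewrite lt_min c0 d0|].
move=> phi s; apply: (le_trans (ler_normD _ _)); rewrite mulrDl; apply: lerD.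
  apply: (le_trans (leg _ s)); rewrite ler_wpM2l // ler_expR !mulNr lerN2.
  by rewrite ler_wpM2r ?ssumsq_ge0 // ge_min lexx.
apply: (le_trans (leh _ s)); rewrite ler_wpM2l // ler_expR !mulNr lerN2.
by rewrite ler_wpM2r ?ssumsq_ge0 // ge_min lexx orbT.
Qed.

Lemma niceB n g h : nice n g -> nice n h -> nice n (fun phi => g phi - h phi).
Proof.
move=> ng nh; apply: (@nice_ext _ (fun phi => g phi + (-1) * h phi)).
  by move=> phi _; rewrite mulN1r.
by apply: niceD => //; exact: niceZ.
Qed.

Lemma nice_le n g h : seq_measurable n h -> nice n g ->
  (forall phi, size phi = n -> `|h phi| <= `|g phi|) -> nice n h.
Proof.
move=> mh [mg [C [c [C0 c0 leg]]]] le; split => //; exists C, c; split => // phi s.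
exact: le_trans (le _ s) (leg _ s).
Qed.

Lemma nice_norm n g : nice n g -> nice n (fun phi => `|g phi|).
Proof.
move=> ng; apply: (nice_le _ ng) => [|phi _]; last by rewrite normr_id.
move=> d T X mX; apply: measurableT_comp => //; exact: ng.1 mX.
Qed.

Lemma iintZ n (a : R) g : nice n g -> iint n (fun phi => a * g phi) = a * iint n g.
Proof.
elim: n g => [|n ih] g ng //=.
rewrite -RintegralZl //; last exact: nice_section_integrable.
by apply: eq_Rintegral => x _; rewrite ih //; exact: nice_cons.
Qed.

Lemma iintD n g h : nice n g -> nice n h ->
  iint n (fun phi => g phi + h phi) = iint n g + iint n h.
Proof.
elim: n g h => [|n ih] g h ng nh //=.
rewrite -RintegralD //; try exact: nice_section_integrable.
by apply: eq_Rintegral => x _; rewrite ih //; exact: nice_cons.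
Qed.

Lemma iintB n g h : nice n g -> nice n h ->
  iint n (fun phi => g phi - h phi) = iint n g - iint n h.
Proof.
move=> ng nh; rewrite -mulN1r -iintZ // -iintD //; last exact: niceZ.
by apply: iint_ext => phi _; rewrite mulN1r.
Qed.

Lemma le_iint n g h : nice n g -> nice n h ->
  (forall phi, size phi = n -> g phi <= h phi) -> iint n g <= iint n h.
Proof.
elim: n g h => [|n ih] g h ng nh le /=; first exact: le.
apply: le_Rintegral => //; try exact: nice_section_integrable.
move=> x _; apply: ih => [||phi s]; try exact: nice_cons.
by apply: le; rewrite /= s.
Qed.

Lemma iint_ge0 n g : (forall phi, size phi = n -> 0 <= g phi) -> 0 <= iint n g.
Proof.
elim: n g => [|n ih] g g0 /=; first exact: g0.
by apply: Rintegral_ge0 => x _; apply: ih => phi s; apply: g0; rewrite /= s.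
Qed.

Lemma le_norm_iint n g : nice n g -> `|iint n g| <= iint n (fun phi => `|g phi|).
Proof.
move=> ng; have nn := nice_norm ng; rewrite ler_norml -mulN1r -iintZ //.
apply/andP; split; apply: le_iint => //; try exact: niceZ.
  by move=> phi _; rewrite mulN1r lerNnormlW.
by move=> phi _; exact: ler_norm.
Qed.

Lemma iint_cat k n g :
  iint (k + n) g = iint k (fun y => iint n (fun psi => g (y ++ psi))).
Proof.
elim: k g => [|k ih] g //=.
by apply: eq_Rintegral => x _; rewrite ih.
Qed.

Lemma nice2_swap n g : nice n.+2 g ->
  \int[mu]_x \int[mu]_y iint n (fun phi => g [:: x, y & phi]) =
  \int[mu]_y \int[mu]_x iint n (fun phi => g [:: x, y & phi]).
Proof.
rewrite -addn2 addnC => /nice_iint [mg [C [c [C0 c0 le]]]].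
apply: (@Rintegral_swap _ C c _ c0).
  apply: (mg _ _ (fun p : R * R => [:: p.1; p.2])).
  apply: (@family_cons 1 _ _ fst) => //.
  by apply: (@family_cons 0 _ _ snd (fun=> [::])).
move=> x y; have := le [:: x; y] erefl.
by rewrite /ssumsq big_cons big_seq1 mulrDr expRD; apply.
Qed.

Definition ins (i : nat) (x : R) phi := take i phi ++ x :: drop i phi.

(** Position [i] becomes outermost after [i] exchanges of integrals: the induction hypothesis moves
    it right behind the first variable, and Fubini swaps these two. *)
Lemma iint_insert n i g : (i <= n)%N -> nice n.+1 g ->
  iint n.+1 g = \int[mu]_x iint n (fun psi => g (ins i x psi)).
Proof.
elim: i n g => [|i ih] n g.
  move=> _ _ /=; apply: eq_Rintegral => x _; apply: iint_ext => phi _.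
  by rewrite /ins take0 drop0.
case: n => [//|n]; rewrite ltnS => ileqn ng.
transitivity (\int[mu]_y \int[mu]_x iint n (fun psi => g (y :: ins i x psi))).
  apply: eq_Rintegral => y _.
  by apply: (ih n (fun phi => g (y :: phi)) ileqn); exact: nice_cons.
(* [g'] is [g] with the two variables to be exchanged stored in front, the form that [nice2_swap]
   handles; the permutation [p] below puts them back in place. *)
pose g' s := g (nth 0 s 1 :: ins i (nth 0 s 0) (drop 2 s)).
have ng' : nice n.+2 g'.
  pose p := (1 :: iota 2 i ++ 0 :: iota (2 + i) (n - i))%N.
  have pp : perm_eq p (iota 0 n.+2).
    have -> : iota 0 n.+2 = (0 :: 1 :: iota 2 i ++ iota (2 + i) (n - i))%N.
      by rewrite -iotaD subnKC.
    by apply/permP => a; rewrite /p /= !count_cat /=; lia.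
  apply: nice_ext (nice_perm pp ng) => -[//|x [//|y s]] [sn].
  rewrite /g' /= drop0 /ins; congr (g (_ :: _)).
  rewrite /p map_cat /=; congr (_ ++ _ :: _).
  - rewrite -[X in iota X](addn0 2) iotaDl -map_comp /=.
    by rewrite map_nth_iota0 // sn.
  - rewrite iotaDl -map_comp.
    rewrite -[X in iota X](addn0 i) iotaDl -map_comp.
    rewrite (eq_map (g := fun j => (drop i s)`_j)); last by move=> j; rewrite /= nth_drop.
    by rewrite map_nth_iota // size_drop sn.
transitivity (\int[mu]_x \int[mu]_y iint n (fun psi => g' [:: x, y & psi])).
  rewrite (nice2_swap ng'); apply: eq_Rintegral => y _; apply: eq_Rintegral => x _.
  by apply: iint_ext => psi _; rewrite /g' /= drop0.
apply: eq_Rintegral => x _ /=; apply: eq_Rintegral => y _; apply: iint_ext => psi _.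
by rewrite /g' /= drop0 /ins.
Qed.

(** Integrating over position [i], the head of [p], outermost turns its variable into the head
    argument of [g]. The other positions, renumbered by [unbump i], form a permutation of one index
    fewer. *)
Lemma iint_perm n (p : seq nat) g : perm_eq p (iota 0 n) -> nice n g ->
  iint n (fun phi => g [seq phi`_i | i <- p]) = iint n g.
Proof.
elim: n p g => [|n ih] p g pp ng.
  by have /perm_size/eqP := pp; rewrite size_iota size_eq0 => /eqP ->.
case: p pp => [/perm_size //|i p] pp.
have ilt : (i <= n)%N.
  have : i \in iota 0 n.+1 by rewrite -(perm_mem pp) mem_head.
  by rewrite mem_iota add0n ltnS.
rewrite (iint_insert ilt) //=; last exact: (nice_perm pp ng).
apply: eq_Rintegral => x _.
pose p' := map (unbump i) p.
have up : uniq (i :: p) by rewrite (perm_uniq pp) iota_uniq.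
have nip j : j \in p -> j != i.
  by move=> jp; apply: contraTneq up => <- /=; rewrite jp.
have ltp j : j \in p -> (j < n.+1)%N.
  move=> jp; have : j \in i :: p by rewrite inE jp orbT.
  by rewrite (perm_mem pp) mem_iota.
have pp' : perm_eq p' (iota 0 n).
  have sp : size p = n by have /perm_size := pp; rewrite size_iota => -[].
  have up' : uniq p'.
    rewrite map_inj_in_uniq; first by case/andP: up.
    move=> j1 j2 /nip n1 /nip n2; rewrite /unbump.
    by case: ltngtP n1; case: ltngtP n2; lia.
  have [|//|_ e] := uniq_min_size up' (s2 := iota 0 n).
  - move=> _ /mapP[j jp ->]; rewrite mem_iota /unbump.
    have := ltp _ jp; have := nip _ jp.
    by case: ltngtP; lia.
  - by rewrite size_map sp size_iota.
  - exact: (uniq_perm up' (iota_uniq _ _)).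
rewrite -[RHS](ih p' _ pp' (@nice_cons _ _ x ng)).
apply: iint_ext => psi s; congr (g (_ :: _)).
  by rewrite /ins nth_cat size_takel ?s // ltnn subnn.
rewrite -map_comp; apply/eq_in_map => j jp.
rewrite /ins nth_cat size_takel ?s // /= /unbump.
have := nip _ jp; case: ltngtP => // ij _.
  by rewrite subn0 nth_take.
have -> : (j - i = (j - i.+1).+1)%N by lia.
by rewrite /= nth_drop; congr nth; lia.
Qed.

End IteratedIntegral.

(** * Volume of thin shells *)

Section ShellVolume.
Context {R : realType}.
Notation mu := (@lebesgue_measure R).
Implicit Types (n i j : nat) (phi : seq R).

(** Mean value inequality for [D^((i+2)/2)], whose derivative [(i+2)/2 * D^(i/2)] is evaluated at
    the upper end. The induction splits [v^(i+3) - u^(i+3)] as [v * (v^(i+2) - u^(i+2)) + u^(i+2) *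
    (v - u)]. *)
Lemma sqrt_pow_diff_le i (A B : R) : A <= B ->
  Num.sqrt B ^+ i.+2 - Num.sqrt A ^+ i.+2 <= i.+2%:R / 2 * Num.sqrt B ^+ i * (B - A).
Proof.
move=> AB.
have key (u v : R) : 0 <= u -> u <= v ->
    v ^+ i.+2 - u ^+ i.+2 <= i.+2%:R / 2 * v ^+ i * (v ^+ 2 - u ^+ 2).
  move=> u0 uv; elim: i => [|i ih]; first by rewrite divff // expr0 !mul1r.
  have v0 : 0 <= v by exact: le_trans uv.
  have h1 : v * (v ^+ i.+2 - u ^+ i.+2) <=
      i.+2%:R / 2 * v ^+ i.+1 * (v ^+ 2 - u ^+ 2).
    by apply: (le_trans (ler_wpM2l v0 ih)); rewrite le_eqVlt (exprS _ i); apply/orP; left; apply/eqP; ring.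
  have h2 : u ^+ i.+2 * (v - u) <= v ^+ i.+1 * ((v + u) / 2) * (v - u).
    rewrite ler_wpM2r ?subr_ge0 // exprSr ler_pM ?exprn_ge0 //; last by lra.
    exact: lerXn2r.
  have -> : v ^+ i.+3 - u ^+ i.+3 = v * (v ^+ i.+2 - u ^+ i.+2) + u ^+ i.+2 * (v - u).
    by rewrite !(exprS _ i.+2); ring.
  apply: (le_trans (lerD h1 h2)); rewrite le_eqVlt; apply/orP; left; apply/eqP.
  by rewrite -(natr1 i.+2); field.
apply: (le_trans (key _ _ (sqrtr_ge0 A) (ler_wsqrtr AB))).
have [B0|B0] := leP B 0.
  by rewrite !ler0_sqrtr ?(le_trans AB) // expr0n subrr mulr0 mulr_ge0 ?subr_ge0 // mulr_ge0 ?exprn_ge0.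
rewrite ler_wpM2l ?mulr_ge0 ?exprn_ge0 ?sqrtr_ge0 // (sqr_sqrtr (ltW B0)) lerD2l lerN2.
by have [A0|A0] := leP A 0; [rewrite ler0_sqrtr // expr0n|rewrite sqr_sqrtr // ltW].
Qed.

(** Same with the derivative at the lower end. With [i = 0] the factor [Num.sqrt A ^+ i] would be 1
    and the bound false for [A < 0]; hence [0 < i]. *)
Lemma sqrt_pow_diff_ge i (A B : R) : (0 < i)%N -> A <= B ->
  i.+2%:R / 2 * Num.sqrt A ^+ i * (B - A) <= Num.sqrt B ^+ i.+2 - Num.sqrt A ^+ i.+2.
Proof.
move=> i0 AB.
have key (u v : R) : 0 <= u -> u <= v ->
    i.+2%:R / 2 * u ^+ i * (v ^+ 2 - u ^+ 2) <= v ^+ i.+2 - u ^+ i.+2.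
  move=> u0 uv; elim: i {i0} => [|i ih]; first by rewrite divff // expr0 !mul1r.
  have v0 : 0 <= v by exact: le_trans uv.
  have h1 : i.+2%:R / 2 * u ^+ i.+1 * (v ^+ 2 - u ^+ 2) <=
      u * (v ^+ i.+2 - u ^+ i.+2).
    by apply: le_trans (ler_wpM2l u0 ih); rewrite le_eqVlt (exprS _ i); apply/orP; left; apply/eqP; ring.
  have h2 : u ^+ i.+1 * ((v + u) / 2) * (v - u) <= v ^+ i.+2 * (v - u).
    rewrite ler_wpM2r ?subr_ge0 // (exprSr v) ler_pM ?exprn_ge0 //; try lra.
    exact: lerXn2r.
  have -> : v ^+ i.+3 - u ^+ i.+3 = u * (v ^+ i.+2 - u ^+ i.+2) + v ^+ i.+2 * (v - u).
    by rewrite !(exprS _ i.+2); ring.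
  apply: le_trans (lerD h1 h2); rewrite le_eqVlt; apply/orP; left; apply/eqP.
  by rewrite -(natr1 i.+2); field.
have [A0|A0] := leP A 0.
  by rewrite !(ler0_sqrtr A0) !expr0n (gtn_eqF i0) /= mulr0 mul0r subr0 exprn_ge0 ?sqrtr_ge0.
apply: le_trans (key _ _ (sqrtr_ge0 A) (ler_wsqrtr AB)).
by rewrite !sqr_sqrtr // ?ltW // (lt_le_trans A0).
Qed.

Definition iv (b : bool) : R := if b then 1 else 0.

Lemma iv_ge0 b : 0 <= iv b. Proof. by case: b. Qed.

Lemma iv_le1 b : iv b <= 1. Proof. by case: b. Qed.

Lemma iv_and b1 b2 : iv (b1 && b2) = iv b1 * iv b2.
Proof. by case: b1; case: b2; rewrite /iv /= ?mulr0 ?mulr1. Qed.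

Lemma measurable_iv d (T : measurableType d) (b : T -> bool) :
  measurable_fun setT b -> measurable_fun setT (fun t => iv (b t)).
Proof. by move=> mb; exact: measurable_fun_ifT. Qed.

Lemma measurable_sqrt : measurable_fun setT (@Num.sqrt R).
Proof. by apply: continuous_measurable_fun; exact: sqrt_continuous. Qed.

(* D_+^(j/2), with value 0 at D <= 0 also when j = 0. *)
Definition hpow j (D : R) : R := Num.sqrt D ^+ j * iv (0 < D).

Lemma hpow_ge0 j D : 0 <= hpow j D.
Proof. by rewrite mulr_ge0 ?iv_ge0 ?exprn_ge0 ?sqrtr_ge0. Qed.

Lemma hpowE j D : (0 < j)%N -> hpow j D = Num.sqrt D ^+ j.
Proof.
move=> j0; rewrite /hpow /iv; case: ltP => D0; rewrite ?mulr1 //.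
by rewrite ler0_sqrtr // expr0n (gtn_eqF j0) mulr0.
Qed.

Lemma measurable_hpow j d (T : measurableType d) (f : T -> R) :
  measurable_fun setT f -> measurable_fun setT (fun t => hpow j (f t)).
Proof.
move=> mf; apply: measurable_funM.
  by apply: measurable_funX; apply: measurableT_comp => //; exact: measurable_sqrt.
by apply: measurable_iv; apply: measurable_fun_ltr => //.
Qed.

Lemma hpow_gauss j (r D : R) : D <= r -> hpow j D <= Num.sqrt r ^+ j * expR D.
Proof.
move=> Dr; rewrite /hpow /iv; case: ltP => D0.
  rewrite ler_pM ?exprn_ge0 ?sqrtr_ge0 //.
    by rewrite lerXn2r ?nnegrE ?sqrtr_ge0 // ler_wsqrtr.
  by rewrite -expR0 ler_expR ltW.
by rewrite mulr0 mulr_ge0 ?expR_ge0 ?exprn_ge0 ?sqrtr_ge0.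
Qed.

Lemma measurable_hpow_sqr j (D kap : R) :
  measurable_fun setT (fun x : R => hpow j (D - kap * x ^+ 2)).
Proof. by apply: measurable_hpow; apply: measurable_funB => //; exact: measurable_funM. Qed.

Lemma hpow_sqr_gauss j (D kap x : R) : 0 <= kap ->
  `|hpow j (D - kap * x ^+ 2)| <= (Num.sqrt D ^+ j * expR D) * expR (- kap * x ^+ 2).
Proof.
move=> k0; rewrite ger0_norm ?hpow_ge0 // -mulrA -expRD mulNr; apply: hpow_gauss.
by rewrite lerBlDr lerDl mulr_ge0 ?sqr_ge0.
Qed.

(** Scaling [x] by [Num.sqrt D] pulls out [D^((j+1)/2)], so [beta] is the integral at [D = 1]. *)
Lemma hpow_step j (kap : R) : 0 < kap -> exists2 beta : R, 0 < beta &
  forall D, \int[mu]_x hpow j (D - kap * x ^+ 2) = beta * hpow j.+1 D.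
Proof.
move=> k0; pose u x := hpow j (1 - kap * x ^+ 2).
have iu : mu.-integrable setT (EFin \o u).
  exact: gauss_dominated_integrable k0 (measurable_hpow_sqr j 1 kap) (fun x => hpow_sqr_gauss j 1 x (ltW k0)).
exists (\int[mu]_x u x).
  (* Since [kap * r ^+ 2 = 3 / 4], the argument of [hpow] is at least 1/4 on [[0, r]] and [u] at
     least [2^-j] there, which makes [beta] positive. *)
  pose r : R := Num.sqrt (3 / (4 * kap)).
  have r0 : 0 < r by rewrite sqrtr_gt0 divr_gt0 // mulr_gt0.
  have r2 : kap * r ^+ 2 = 3 / 4.
    rewrite sqr_sqrtr; first by field; exact: lt0r_neq0.
    by rewrite divr_ge0 // mulr_ge0 // ltW.
  have ii : mu.-integrable setT (EFin \o (fun x : R => 2^-1 ^+ j * \1_`[0, r]%classic x)).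
    rewrite (_ : EFin \o _ = fun x => ((2^-1 ^+ j)%:E * (\1_`[0, r]%classic x)%:E)%E); last first.
      by apply/funext => x; rewrite /= EFinM.
    by apply: integrableZl => //; exact: integrable_indic_itv.
  have : \int[mu]_x (2^-1 ^+ j * \1_`[0, r]%classic x) <= \int[mu]_x u x.
    apply: le_Rintegral => // x _; rewrite indicE.
    have [|_] := boolP (x \in _); last by rewrite mulr0 hpow_ge0.
    rewrite inE /= in_itv /= => /andP[x0 xr].
    have hx : 4^-1 <= 1 - kap * x ^+ 2.
      have : kap * x ^+ 2 <= kap * r ^+ 2.
        apply: (ler_wpM2l (ltW k0)); rewrite lerXn2r ?nnegrE //; exact: ltW.
      by rewrite r2; lra.
    rewrite mulr1 /u /hpow /iv ifT; last by apply: lt_le_trans hx; rewrite invr_gt0.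
    rewrite mulr1 lerXn2r ?nnegrE ?sqrtr_ge0 //.
    have -> : 2^-1 = Num.sqrt (4^-1) :> R.
      have -> : 4^-1 = 2^-1 ^+ 2 :> R by field.
      by rewrite sqrtr_sqr ger0_norm.
    exact: ler_wsqrtr.
  apply: lt_le_trans.
  rewrite RintegralZl //; last exact: integrable_indic_itv.
  rewrite mulr_gt0 ?exprn_gt0 // /Rintegral integral_indic // setIT.
  have h : mu (`[0, r]%classic : set R) = r%:E.
    by rewrite lebesgue_measure_itv /= lte_fin r0 -EFinB subr0.
  by rewrite [X in fine X]h.
move=> D; have [D0|D0] := leP D 0.
  rewrite [RHS](_ : _ = 0); last by rewrite /hpow /iv ltNge D0 /= !mulr0.
  transitivity (\int[mu]_(x in setT) (0 : R)); last by rewrite Rintegral_cst // mul0r.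
  apply: eq_Rintegral => x _; rewrite /hpow /iv ltNge.
  have -> : D - kap * x ^+ 2 <= 0.
    by rewrite subr_le0 (le_trans D0) // mulr_ge0 ?sqr_ge0 // ltW.
  by rewrite mulr0.
have s0 : 0 < Num.sqrt D by rewrite sqrtr_gt0.
rewrite (@Rintegral_affine _ (Num.sqrt D) 0 _ s0); last exact: measurable_hpow_sqr.
rewrite (_ : \int[mu]_x _ = \int[mu]_x (Num.sqrt D ^+ j * u x)); last first.
  apply: eq_Rintegral => x _; rewrite addr0 exprMn sqr_sqrtr ?ltW //.
  have -> : D - kap * (D * x ^+ 2) = D * (1 - kap * x ^+ 2) by ring.
  by rewrite /u /hpow pmulr_rgt0 // (sqrtrM _ (ltW D0)) exprMn mulrA.
by rewrite RintegralZl // /hpow /iv D0 mulr1 exprS mulrA mulrC.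
Qed.

Lemma slab_ball_nice n (a b r : R) :
  nice n (fun phi => iv (a < ssum phi < b) * iv (ssumsq phi < r)).
Proof.
split.
  move=> d T X mX; apply: measurable_funM; apply: measurable_iv.
    by apply: measurable_and; apply: measurable_fun_ltr => //; exact: family_ssum mX.
  by apply: measurable_fun_ltr => //; exact: family_ssumsq mX.
exists (expR r), 1; split => // phi _.
rewrite ger0_norm ?mulr_ge0 ?iv_ge0 // -expRD mulN1r.
rewrite -[leRHS]mul1r ler_pM ?iv_ge0 ?iv_le1 // /iv.
case: ltP => h; last exact: expR_ge0.
by rewrite -expR0 ler_expR subr_ge0 ltW.
Qed.

(* Completing the square, x^2 + (s-x)^2/m = s^2/(m+1) + (m+1)/m (x - s/(m+1))^2, integrates
   out one more coordinate in the induction on the dimension. *)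
Lemma slab_ball_volume n : exists2 c : R, 0 < c & forall a b r,
  iint n.+1 (fun phi => iv (a < ssum phi < b) * iv (ssumsq phi < r)) =
  c * \int[mu]_s (iv (a < s < b) * hpow n (r - s ^+ 2 / n.+1%:R)).
Proof.
elim: n => [|n [c c0 ih]].
  exists 1 => // a b r; rewrite mul1r /=; apply: eq_Rintegral => x _.
  by rewrite ssum_cons ssumsq_cons /ssum /ssumsq !big_nil !addr0 /hpow expr0 mul1r divr1 subr_gt0.
have [M ME] : exists M : R, M = n.+1%:R by exists n.+1%:R.
have M1 : 1 <= M by rewrite ME ler1n.
have M0 : 0 < M by exact: lt_le_trans M1.
have M20 : n.+2%:R = M + 1 :> R by rewrite ME natr1.
have [beta b0 hb] := @hpow_step n ((M + 1) / M) ltac:(by rewrite divr_gt0 // addr_gt0).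
exists (c * beta); first exact: mulr_gt0.
move=> a b r.
pose u (x s : R) := iv (a < s < b) * hpow n (r - x ^+ 2 - (s - x) ^+ 2 / M).
have mu2 : measurable_fun setT (fun p : R * R => u p.1 p.2).
  apply: measurable_funM.
    by apply: measurable_iv; apply: measurable_and; apply: measurable_fun_ltr.
  apply: measurable_hpow; apply: measurable_funB.
    by apply: measurable_funB => //; apply: measurable_funX.
  by apply: measurable_funM => //; apply: measurable_funX; apply: measurable_funB.
(* Gaussian domination for Fubini: [x^2 + (s - x)^2 / M >= (x^2 + s^2) / (3 M)] because [M >= 1]. *)
have le x s : `|u x s| <= (Num.sqrt r ^+ n * expR r) *
    (expR (- (3 * M)^-1 * x ^+ 2) * expR (- (3 * M)^-1 * s ^+ 2)).
  rewrite ger0_norm ?mulr_ge0 ?iv_ge0 ?hpow_ge0 //.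
  rewrite -[leLHS]mul1r mulrCA -[leRHS]mul1r ler_pM ?iv_ge0 ?iv_le1 ?mul1r ?hpow_ge0 //.
  have q0 : 0 <= (s - x) ^+ 2 / M by rewrite divr_ge0 ?sqr_ge0 // ltW.
  have x0 := sqr_ge0 x.
  have ler' : r - x ^+ 2 - (s - x) ^+ 2 / M <= r by rewrite -addrA gerDl -opprD oppr_le0 addr_ge0.
  apply: (le_trans (hpow_gauss n ler')).
  rewrite -mulrA ler_wpM2l ?exprn_ge0 ?sqrtr_ge0 // -!expRD ler_expR -mulrDr.
  rewrite mulNr -addrA lerD2l -opprD lerN2.
  rewrite ler_pdivrMl ?mulr_gt0 //.
  have -> : 3 * M * (x ^+ 2 + (s - x) ^+ 2 / M) = 3 * M * x ^+ 2 + (s - x) ^+ 2 * 3.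
    by field; exact: lt0r_neq0.
  have h1 : x ^+ 2 * 3 <= 3 * M * x ^+ 2.
    by rewrite mulrC -mulrA ler_wpM2l // -[leLHS]mul1r ler_wpM2r.
  suff : x ^+ 2 + s ^+ 2 <= 3 * x ^+ 2 + (s - x) ^+ 2 * 3 by lra.
  have := sqr_ge0 (s - 2 * x); nra.
transitivity (\int[mu]_x (c * \int[mu]_s u x s)).
  rewrite iintS; apply: eq_Rintegral => x _.
  transitivity (iint n.+1 (fun phi =>
     iv (a - x < ssum phi < b - x) * iv (ssumsq phi < r - x ^+ 2))).
    apply: iint_ext => phi _; rewrite ssum_cons ssumsq_cons.
    by rewrite ltrBlDl !ltrBrDl.
  rewrite ih; congr (_ * _); rewrite -(Rintegral_translate (- x)).
    apply: eq_Rintegral => s _; rewrite /u; congr (iv _ * hpow n (_ - _ / _)) => //.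
    by rewrite !ltrD2r.
  apply: measurable_funM.
    by apply: measurable_iv; apply: measurable_and; apply: measurable_fun_ltr.
  apply: measurable_hpow; apply: measurable_funB => //.
  by apply: measurable_funM => //; apply: measurable_funX.
have K0 : 0 < (3 * M)^-1 by rewrite invr_gt0 mulr_gt0.
rewrite RintegralZl //; last exact: gauss_section_integrable K0 mu2 le.
rewrite -mulrA; congr (_ * _).
have lin s : \int[mu]_x u x s =
    beta * (iv (a < s < b) * hpow n.+1 (r - s ^+ 2 / n.+2%:R)).
  rewrite /u /iv; case: ifP => _; last first.
    rewrite mul0r mulr0; transitivity (\int[mu]_(x in setT) (0 : R)).
      by apply: eq_Rintegral => x _; rewrite mul0r.
    by rewrite Rintegral_cst // mul0r.
  rewrite mul1r M20 -hb -[RHS](Rintegral_translate (- (s / (M + 1)))).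
    apply: eq_Rintegral => x _; rewrite mul1r; congr hpow.
    have M10 : M + 1 != 0 by rewrite lt0r_neq0 // addr_gt0.
    by field; rewrite (lt0r_neq0 M0) M10.
  exact: measurable_hpow_sqr.
rewrite (Rintegral_swap K0 mu2 le) -RintegralZl //; first exact: eq_Rintegral.
have M20' : 0 < (n.+2%:R : R)^-1 by rewrite invr_gt0.
apply: (@gauss_dominated_integrable _ (Num.sqrt r ^+ n.+1 * expR r) (n.+2%:R)^-1) => //.
  apply: measurable_funM.
    by apply: measurable_iv; apply: measurable_and; apply: measurable_fun_ltr.
  under eq_fun do rewrite [_ / n.+2%:R]mulrC; exact: measurable_hpow_sqr.
move=> s; rewrite [_ / n.+2%:R]mulrC normrM -[leRHS]mul1r ler_pM //.
  by rewrite ger0_norm ?iv_ge0 ?iv_le1.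
exact: hpow_sqr_gauss (ltW _).
Qed.


Lemma slab_hpow_integrable j (N a b r : R) : 0 < N ->
  mu.-integrable setT (EFin \o (fun t : R => iv (a < t < b) * hpow j (r - t ^+ 2 / N))).
Proof.
move=> N0; have N0' : 0 < N^-1 by rewrite invr_gt0.
apply: (@gauss_dominated_integrable _ (Num.sqrt r ^+ j * expR r) N^-1) => //.
  apply: measurable_funM.
    by apply: measurable_iv; apply: measurable_and; apply: measurable_fun_ltr.
  under eq_fun do rewrite [_ / N]mulrC; exact: measurable_hpow_sqr.
move=> s; rewrite [_ / N]mulrC normrM -[leRHS]mul1r ler_pM //.
  by rewrite ger0_norm ?iv_ge0 ?iv_le1.
exact: hpow_sqr_gauss (ltW _).
Qed.

Lemma slab_indic (a b t : R) : iv (a < t < b) = \1_`]a, b[%classic t.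
Proof. by rewrite indicE mem_setE in_itv /= /iv; case: (_ && _). Qed.

Lemma slab_cst_integrable (K a b : R) :
  mu.-integrable setT (EFin \o (fun t : R => iv (a < t < b) * K)).
Proof.
rewrite (_ : EFin \o _ = fun x => (K%:E * (\1_`]a, b[%classic x)%:E)%E).
  by apply: integrableZl => //; exact: integrable_indic_itv.
by apply/funext => x; rewrite /= slab_indic mulrC EFinM.
Qed.

Lemma Rintegral_slab (K a b : R) : a < b ->
  \int[mu]_t (iv (a < t < b) * K) = (b - a) * K.
Proof.
move=> ab; transitivity (\int[mu]_t (\1_`]a, b[%classic t * K)).
  by apply: eq_Rintegral => t _; rewrite slab_indic.
rewrite RintegralZr //; last exact: integrable_indic_itv.
congr (_ * _); rewrite /Rintegral integral_indic // setIT.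
have h : mu (`]a, b[%classic : set R) = (b - a)%:E.
  by rewrite lebesgue_measure_itv /= lte_fin ab.
by rewrite [X in fine X]h.
Qed.

Definition shell_volume n (s q d : R) : R :=
  iint n (fun psi => iv ((`|ssum psi - s| < d) && (`|ssumsq psi - q| < d))).

Lemma shell_nice n (s q d : R) :
  nice n (fun psi => iv ((`|ssum psi - s| < d) && (`|ssumsq psi - q| < d))).
Proof.
apply: nice_le (slab_ball_nice n (s - d) (s + d) (q + d)) _ => [d' T X mX|phi _].
  have mS := family_ssum mX; have mQ := family_ssumsq mX.
  by apply: measurable_iv; apply: measurable_and; apply: measurable_fun_ltr => //;
    apply: measurableT_comp => //; apply: measurable_funB.
rewrite [leLHS]ger0_norm ?iv_ge0 // [leRHS]ger0_norm ?mulr_ge0 ?iv_ge0 //.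
rewrite [leLHS]iv_and !ltr_distl ler_pM ?iv_ge0 // /iv.
by case: (q - d < _); case: (_ < q + d).
Qed.

Lemma slab_sqr_close (N s t d : R) : 1 <= N -> 0 < d <= 1 -> s - d < t < s + d ->
  `|t ^+ 2 / N - s ^+ 2 / N| <= (2 * `|s| + 1) * d.
Proof.
move=> N1 /andP[d0 d1]; rewrite -ltr_distl => td.
rewrite -mulrBl normrM [`|N^-1|]ger0_norm ?invr_ge0 ?(le_trans _ N1) //.
have h : `|t ^+ 2 - s ^+ 2| <= (2 * `|s| + 1) * d.
  rewrite subr_sqr normrM mulrC ler_pM // ?(ltW td) //.
  have -> : t + s = (t - s) + 2 * s by ring.
  by rewrite (le_trans (ler_normD _ _)) // normrM ger0_norm // addrC lerD2l (le_trans (ltW td)).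
rewrite -[leRHS]mulr1 ler_pM ?invr_ge0 ?(le_trans _ N1) // invf_le1 //.
exact: lt_le_trans N1.
Qed.

(** A shell is a slab intersected with a difference of two balls, so the mean value inequalities
    apply to the volume formula. Slab width [2 d], radius gap [2 d] and derivative factor [n.+3 / 2]
    give the constant [2 * n.+3 * c]. In dimension [n.+4] the exponent drops from [n.+3] to [n.+1],
    which is positive as the lower bound requires. [lam] collects [2 |s| + 1] from moving [t] within
    the slab and 1 from the radius. *)
Lemma shell_volume_bounds n : exists2 c : R, 0 < c & forall s q d D lam : R,
  0 < d <= 1 -> D = q - s ^+ 2 / n.+4%:R -> lam = 2 * `|s| + 2 ->
  c * d ^+ 2 * Num.sqrt (D - lam * d) ^+ n.+1 <= shell_volume n.+4 s q d <=
  c * d ^+ 2 * Num.sqrt (D + lam * d) ^+ n.+1.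
Proof.
have [c c0 hc] := slab_ball_volume n.+3.
exists (2 * n.+3%:R * c); first by rewrite !mulr_gt0.
move=> s q d D lam /andP[d0 d1] DE lamE.
have [N NE] : exists N : R, N = n.+4%:R by exists n.+4%:R.
have N0 : 0 < N by rewrite NE ltr0n.
have N1 : 1 <= N by rewrite NE ler1n.
have sd : s - d < s + d by lra.
pose F r := iint n.+4 (fun phi => iv (s - d < ssum phi < s + d) * iv (ssumsq phi < r)).
have FB r1 r2 : F r2 - F r1 = c * \int[mu]_t (iv (s - d < t < s + d) *
    (hpow n.+3 (r2 - t ^+ 2 / N) - hpow n.+3 (r1 - t ^+ 2 / N))).
  rewrite /F !hc -NE -mulrBr -RintegralB //; [|exact: slab_hpow_integrable..].
  by congr (_ * _); apply: eq_Rintegral => t _; rewrite mulrBr.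
have iFB r1 r2 : mu.-integrable setT (EFin \o (fun t : R => iv (s - d < t < s + d) *
    (hpow n.+3 (r2 - t ^+ 2 / N) - hpow n.+3 (r1 - t ^+ 2 / N)))).
  have := integrableB measurableT (slab_hpow_integrable n.+3 (s - d) (s + d) r2 N0)
    (slab_hpow_integrable n.+3 (s - d) (s + d) r1 N0).
  apply: eq_integrable => // t _ /=.
  by rewrite -EFinB mulrBr.
have FBnice r1 r2 : nice n.+4 (fun phi =>
    iv (s - d < ssum phi < s + d) * iv (ssumsq phi < r2) -
    iv (s - d < ssum phi < s + d) * iv (ssumsq phi < r1)).
  by apply: niceB; exact: slab_ball_nice.
have close t : s - d < t < s + d -> `|t ^+ 2 / N - s ^+ 2 / N| <= (2 * `|s| + 1) * d.
  by apply: slab_sqr_close => //; rewrite d0.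
apply/andP; split.
  pose X := n.+3%:R / 2 * Num.sqrt (D - lam * d) ^+ n.+1.
  have X0 : 0 <= X by rewrite mulr_ge0 ?exprn_ge0 ?sqrtr_ge0 // divr_ge0.
  (* The margin [e] removes the sphere [ssumsq = q - d], which is outside the open shell but counted
     in [F (q + d) - F (q - d)]. It is made arbitrarily small afterwards. *)
  have low e : 0 < e -> e <= d -> c * ((2 * d) * (X * (2 * d - e))) <= shell_volume n.+4 s q d.
    move=> e0 ed; apply: (@le_trans _ _ (F (q + d) - F (q - d + e))).
      rewrite FB ler_wpM2l ?(ltW c0) //.
      have -> : 2 * d = (s + d) - (s - d) by ring.
      rewrite -Rintegral_slab //; apply: le_Rintegral => //.
        exact: slab_cst_integrable.
      move=> t _; rewrite /iv; case: ifP => [/close|_]; last by rewrite !mul0r.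
      rewrite ler_norml !mul1r !hpowE // => /andP[t1 t2].
      apply: le_trans (@sqrt_pow_diff_ge n.+1 _ _ _ _) => //; last by lra.
      rewrite /X -mulrA -[leRHS]mulrA ler_wpM2l ?divr_ge0 //.
      have -> : q + d - t ^+ 2 / N - (q - d + e - t ^+ 2 / N) = s + d - (s - d) - e by ring.
      rewrite ler_wpM2r //; first by lra.
      rewrite lerXn2r ?nnegrE ?sqrtr_ge0 // ler_wsqrtr // DE lamE -NE; lra.
    rewrite /F -iintB; [|exact: slab_ball_nice..].
    apply: le_iint => // [|phi _]; first exact: shell_nice.
    rewrite [leRHS]iv_and !ltr_distl -mulrBr ler_wpM2l ?iv_ge0 // /iv.
    case: (ltP (ssumsq phi) (q + d)) => h1; case: (ltP (ssumsq phi) (q - d + e)) => h2;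
      case: (ltP (q - d) (ssumsq phi)) => h3 /=; clear -d0 e0 h1 h2 h3; lra.
  suff : c * (2 * d * (X * (2 * d))) <= shell_volume n.+4 s q d.
    apply: le_trans; rewrite le_eqVlt /X; apply/orP; left; apply/eqP; by field.
  apply/ler_addgt0Pr => e e0.
  have K0 : 0 < c * (2 * d) * X + 1.
    by rewrite ltr_wpDl // !mulr_ge0 // ?(ltW c0) // (ltW d0).
  pose e' := Num.min d (e / (c * (2 * d) * X + 1)).
  have e'0 : 0 < e' by rewrite lt_min d0 divr_gt0.
  have e'd : e' <= d by rewrite ge_min lexx.
  have e'e : e' * (c * (2 * d) * X + 1) <= e by rewrite -ler_pdivlMr // ge_min lexx orbT.
  have := low _ e'0 e'd; lra.
pose X := n.+3%:R / 2 * Num.sqrt (D + lam * d) ^+ n.+1.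
apply: (@le_trans _ _ (F (q + d) - F (q - d))).
  rewrite /F -iintB; [|exact: slab_ball_nice..].
  apply: le_iint => // [|phi _]; first exact: shell_nice.
  rewrite [leLHS]iv_and !ltr_distl -mulrBr ler_wpM2l ?iv_ge0 // /iv.
  case: (ltP (ssumsq phi) (q + d)) => h1; case: (ltP (ssumsq phi) (q - d)) => h2;
    case: (ltP (q - d) (ssumsq phi)) => h3 /=; clear -d0 h1 h2 h3; lra.
apply: (@le_trans _ _ (c * ((2 * d) * (X * (2 * d))))); last first.
  by rewrite le_eqVlt /X; apply/orP; left; apply/eqP; field.
rewrite FB ler_wpM2l ?(ltW c0) //.
have -> : 2 * d = (s + d) - (s - d) by ring.
rewrite -Rintegral_slab //; apply: le_Rintegral => //.
  exact: slab_cst_integrable.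
move=> t _; rewrite /iv; case: ifP => [/close|_]; last by rewrite !mul0r.
rewrite ler_norml !mul1r !hpowE // => /andP[t1 t2].
apply: (le_trans (@sqrt_pow_diff_le n.+1 _ _ _)); first by lra.
rewrite /X -mulrA -[leRHS]mulrA ler_wpM2l ?divr_ge0 //.
have -> : q + d - t ^+ 2 / N - (q - d - t ^+ 2 / N) = s + d - (s - d) by ring.
rewrite ler_wpM2r //; first by lra.
rewrite lerXn2r ?nnegrE ?sqrtr_ge0 // ler_wsqrtr // DE lamE -NE; lra.
Qed.

End ShellVolume.

(** * Marginals *)

Section Marginals.
Context {R : realType}.
Notation mu := (@lebesgue_measure R).
Implicit Types (n k : nat) (g h : seq R -> R) (phi psi y : seq R).

(** Every rate [c > 0] is required because the decay rate of a [nice] partner is not known in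
    advance; half of that rate is then spent on [h]. *)
Definition subgauss n h : Prop := seq_measurable n h /\
  forall c : R, 0 < c -> exists K : R, 0 <= K /\
    forall phi, size phi = n -> `|h phi| <= K * expR (c * ssumsq phi).

Lemma nice_subgauss n h g : subgauss n h -> nice n g -> nice n (fun phi => h phi * g phi).
Proof.
move=> [mh sh] [mg [C [c [C0 c0 le]]]]; split.
  by move=> d T X mX; apply: measurable_funM; [exact: mh|exact: mg].
have c2 : 0 < c / 2 by rewrite divr_gt0.
have [K [K0 leK]] := sh _ c2.
exists (K * C), (c / 2); split => // [|phi s]; first exact: mulr_ge0.
rewrite normrM; apply: (le_trans (ler_pM _ _ (leK _ s) (le _ s))) => //.
rewrite mulrACA -expRD -mulrDl; have -> : c / 2 + - c = - (c / 2) by field.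
by rewrite lexx.
Qed.

Lemma subgauss_take k n h : subgauss k h -> subgauss (k + n) (fun phi => h (take k phi)).
Proof.
have tk phi : size phi = (k + n)%N -> size (take k phi) = k.
  by move=> s; rewrite size_takel // s leq_addr.
move=> [mh sh]; split.
  move=> d T X [sX mX]; apply: mh; split=> [t|i]; first exact: tk.
  have [ik|ik] := ltnP i k; first by under eq_fun do rewrite nth_take //; exact: mX.
  by under eq_fun do rewrite nth_default ?tk //; exact: measurable_cst.
move=> c c0; have [K [K0 le]] := sh c c0; exists K; split => // phi s.
apply: (le_trans (le _ (tk _ s))); apply: (ler_wpM2l K0).
rewrite ler_expR; apply: (ler_wpM2l (ltW c0)).
by rewrite -[in leRHS](cat_take_drop k phi) ssumsq_cat lerDl ssumsq_ge0.
Qed.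

Lemma subgauss_norm n h : subgauss n h -> subgauss n (fun phi => `|h phi|).
Proof.
move=> [mh sh]; split.
  by move=> d T X mX; apply: measurableT_comp => //; exact: mh.
by move=> c /sh[K [K0 le]]; exists K; split => // phi s; rewrite normr_id le.
Qed.

Lemma subgauss_cst n (a : R) : subgauss n (fun=> a).
Proof.
split; first exact: seq_measurable_cst.
move=> c c0; exists `|a|; split => // phi _; rewrite ler_peMr // -expR0 ler_expR.
by rewrite mulr_ge0 ?ssumsq_ge0 // ltW.
Qed.

Lemma nice_cat n y g : nice (size y + n) g -> nice n (fun psi => g (y ++ psi)).
Proof. by elim: y g => [//|x y ih] g /(@nice_cons _ _ _ x)/ih. Qed.

Definition on_seq k (f : ('I_k -> R) -> R) y : R := f (fun j => y`_j).

(** Symmetry of [g] allows the sites of [I] to be moved to the front. The right-hand side no longer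
    mentions [I], which makes all later bounds uniform in [I]. *)
Lemma iint_marginal k n (I : 'I_k -> 'I_(k + n)) (f : ('I_k -> R) -> R) g :
  injective I -> subgauss k (on_seq f) -> nice (k + n) g ->
  (forall phi psi, perm_eq phi psi -> g phi = g psi) ->
  iint (k + n) (fun phi => f (restr I phi) * g phi) =
  iint k (fun y => on_seq f y * iint n (fun psi => g (y ++ psi))).
Proof.
move=> injI sf ng pg.
pose pI := [seq val (I j) | j <- enum 'I_k].
pose p := pI ++ [seq i <- iota 0 (k + n) | i \notin pI].
have szI : size pI = k by rewrite size_map size_enum_ord.
have upI : uniq pI by rewrite map_inj_uniq ?enum_uniq // => i j /val_inj/injI.
have pp : perm_eq p (iota 0 (k + n)).
  apply: uniq_perm; rewrite ?iota_uniq //; last move=> i.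
    rewrite cat_uniq upI filter_uniq ?iota_uniq // andbT /=.
    by apply/hasPn => i; rewrite mem_filter => /andP[].
  rewrite mem_cat mem_filter; case: (boolP (i \in pI)) => [/mapP[j _ ->]|//].
  by rewrite mem_iota ltn_ord.
pose G phi := on_seq f (take k phi) * g phi.
have nG : nice (k + n) G by apply: nice_subgauss => //; exact: subgauss_take.
transitivity (iint (k + n) (fun phi => G [seq phi`_i | i <- p])).
  apply: iint_ext => phi s; rewrite /G (pg _ _ (perm_map_nth s pp)); congr (_ * _).
  rewrite /on_seq /p map_cat take_size_cat; last by rewrite size_map szI.
  congr f; apply/funext => j; rewrite /restr -map_comp (nth_map j); last by rewrite size_enum_ord.
  by rewrite /comp nth_ord_enum.
rewrite (iint_perm pp nG) iint_cat; apply: iint_ext => y s.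
rewrite -iintZ; last by apply: nice_cat; rewrite s.
by apply: iint_ext => psi _; rewrite /G take_size_cat.
Qed.

Lemma gc_weight_cat (mu0 eta : R) phi psi :
  gc_weight mu0 eta (phi ++ psi) = gc_weight mu0 eta phi * gc_weight mu0 eta psi.
Proof. by rewrite /gc_weight ssum_cat ssumsq_cat -expRD; congr expR; ring. Qed.

Lemma gc_weight_nice n (mu0 eta : R) : 0 < eta -> nice n (gc_weight mu0 eta).
Proof.
move=> e0; split.
  move=> d T X mX; apply: measurableT_comp => //.
  by apply: measurable_funB; apply: measurable_funM => //;
    [exact: family_ssum mX|exact: family_ssumsq mX].
(* Per site, completing the square gives [- mu0 x - eta x^2 <= mu0^2 / (2 eta) - (eta / 2) x^2]. *)
exists (expR (n%:R * (mu0 ^+ 2 / (2 * eta)))), (eta / 2); split.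
- exact: expR_ge0.
- by rewrite divr_gt0.
move=> phi s; rewrite /gc_weight ger0_norm ?expR_ge0 // -expRD ler_expR.
elim: phi n s => [|x phi ih] n s.
  by rewrite -s /ssum /ssumsq !big_nil !mulr0 mul0r; lra.
case: n s => // n [s']; have := ih n s'; rewrite ssum_cons ssumsq_cons -(natr1 n).
have : - mu0 * x - eta * x ^+ 2 <= mu0 ^+ 2 / (2 * eta) - eta / 2 * x ^+ 2.
  have : 0 <= (eta * x + mu0) ^+ 2 / (2 * eta) by rewrite divr_ge0 ?sqr_ge0 // mulr_ge0 // ltW.
  have -> : (eta * x + mu0) ^+ 2 / (2 * eta) =
    eta / 2 * x ^+ 2 + mu0 * x + mu0 ^+ 2 / (2 * eta) by field; exact: lt0r_neq0.
  by lra.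
move: (mu0 ^+ 2 / (2 * eta)) (ssum phi) (ssumsq phi) (n%:R : R) => w S Q N; nra.
Qed.

Lemma Rintegral_expNsqr_gt0 (c : R) : 0 < c -> 0 < \int[mu]_x expR (- c * x ^+ 2).
Proof.
move=> c0; have s0 : 0 < Num.sqrt c by rewrite sqrtr_gt0.
have := Rintegral_dilate s0 (@measurable_gauss_fun R).
rewrite [X in _ * X]/Rintegral integralT_gauss /= => h.
have -> : \int[mu]_x expR (- c * x ^+ 2) = (Num.sqrt c)^-1 * Num.sqrt pi.
  rewrite -h; apply: eq_Rintegral => x _.
  by rewrite /gauss_fun exprMn (sqr_sqrtr (ltW c0)) mulNr.
by rewrite mulr_gt0 ?invr_gt0 // sqrtr_gt0 pi_gt0.
Qed.

(** The weight factorises over sites, each factor being a multiple of a Gaussian centred at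
    [- mu0 / (2 eta)]. Positivity makes the quotient in [gc_avg] genuine. *)
Lemma iint_gc_weight_gt0 n (mu0 eta : R) : 0 < eta -> 0 < iint n (gc_weight mu0 eta).
Proof.
move=> e0; elim: n => [|n ih]; first exact: expR_gt0.
have n1 := gc_weight_nice 1 mu0 e0.
have E x : iint n (fun phi => gc_weight mu0 eta (x :: phi)) =
    gc_weight mu0 eta [:: x] * iint n (gc_weight mu0 eta).
  rewrite -iintZ; last exact: gc_weight_nice.
  by apply: iint_ext => phi _; rewrite -cat1s gc_weight_cat.
rewrite iintS; under eq_Rintegral do rewrite E.
rewrite RintegralZr //; last exact: (nice_section_integrable n1).
rewrite mulr_gt0 // {ih E n1}.
have me : measurable_fun setT (fun x : R => expR (- eta * x ^+ 2)) by exact: measurable_expNsqr.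
have e2 : eta != 0 by rewrite lt0r_neq0.
have -> : \int[mu]_x gc_weight mu0 eta [:: x] =
    expR (mu0 ^+ 2 / (4 * eta)) * \int[mu]_x expR (- eta * x ^+ 2).
  rewrite -(@Rintegral_translate _ (mu0 / (2 * eta)) _ me) -RintegralZl //; last first.
    apply: (@gauss_dominated_integrable _ (expR (mu0 ^+ 2 / (2 * eta))) (eta / 2)).
    - by rewrite divr_gt0.
    - apply: measurableT_comp => //; apply: measurable_funM => //.
      by apply: measurable_funX; apply: measurable_funD.
    move=> x; rewrite ger0_norm ?expR_ge0 // -expRD ler_expR.
    have : 0 <= (eta * x + mu0) ^+ 2 / (2 * eta) by rewrite divr_ge0 ?sqr_ge0 // mulr_ge0 // ltW.
    have -> : (eta * x + mu0) ^+ 2 / (2 * eta) =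
      eta * (x + mu0 / (2 * eta)) ^+ 2 - eta / 2 * x ^+ 2 + mu0 ^+ 2 / (4 * eta) by field.
    have : 0 <= mu0 ^+ 2 / (4 * eta) by rewrite divr_ge0 ?sqr_ge0 // mulr_ge0 // ltW.
    have -> : mu0 ^+ 2 / (2 * eta) = mu0 ^+ 2 / (4 * eta) *+ 2 by rewrite mulr2n; field.
    by rewrite mulr2n; lra.
  apply: eq_Rintegral => x _; rewrite /gc_weight /ssum /ssumsq !big_seq1 -expRD.
  by congr expR; field.
by rewrite mulr_gt0 ?expR_gt0 // Rintegral_expNsqr_gt0.
Qed.

(** The sites outside [I] contribute the same factor to numerator and denominator, so the value
    depends on neither [n] nor [I]. *)
Lemma gc_avg_marginal k n (I : 'I_k -> 'I_(k + n)) (f : ('I_k -> R) -> R) (mu0 eta : R) :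
  injective I -> subgauss k (on_seq f) -> 0 < eta ->
  gc_avg mu0 eta (k + n) (fun phi => f (restr I phi)) =
  iint k (fun y => on_seq f y * gc_weight mu0 eta y) / iint k (gc_weight mu0 eta).
Proof.
move=> injI sf e0; rewrite /gc_avg iint_marginal //; [|exact: gc_weight_nice|]; last first.
  by move=> phi psi pp; rewrite /gc_weight (perm_ssum pp) (perm_ssumsq pp).
have Zn := iint_gc_weight_gt0 n mu0 e0; have Zk := iint_gc_weight_gt0 k mu0 e0.
have nw j : nice j (gc_weight mu0 eta) by exact: gc_weight_nice.
have E y : iint n (fun psi => gc_weight mu0 eta (y ++ psi)) =
    iint n (gc_weight mu0 eta) * gc_weight mu0 eta y.
  rewrite mulrC -iintZ //; apply: iint_ext => psi _; exact: gc_weight_cat.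
have -> : iint (k + n) (gc_weight mu0 eta) =
    iint n (gc_weight mu0 eta) * iint k (gc_weight mu0 eta).
  by rewrite iint_cat -iintZ //; apply: iint_ext => y _; rewrite E.
have -> : iint k (fun y => on_seq f y * iint n (fun psi => gc_weight mu0 eta (y ++ psi))) =
    iint n (gc_weight mu0 eta) * iint k (fun y => on_seq f y * gc_weight mu0 eta y).
  rewrite -iintZ; last exact: nice_subgauss.
  by apply: iint_ext => y _; rewrite E mulrCA.
by rewrite invfM mulrACA mulfV ?mul1r // lt0r_neq0.
Qed.

End Marginals.

(** * The limit of thin shells *)

Section MicrocanonicalLimit.
Context {R : realType}.
Notation mu := (@lebesgue_measure R).
Implicit Types (n k : nat) (g h : seq R -> R) (phi psi y : seq R).

Lemma cvg_at_right_linear (F : R -> R) (l L : R) :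
  (forall d, 0 < d <= 1 -> `|F d - l| <= L * d) -> F @ 0^'+ --> l.
Proof.
move=> H.
have L0 : 0 <= L.
  by have := H 1; rewrite mulr1 ltr01 lexx => /(_ isT); exact: le_trans.
have L1 : 0 < L + 1 by lra.
apply/cvgrPdist_le => e e0; near=> d.
have d0 : 0 < d by near: d; exact: nbhs_right_gt.
have d1 : d <= 1 by near: d; exact: nbhs_right_le.
have dL : d <= e / (L + 1).
  by near: d; apply: nbhs_right_le; rewrite divr_gt0.
rewrite distrC; apply: (le_trans (H d _)); first by rewrite d0.
move: dL; rewrite ler_pdivlMr // mulrDr mulr1 mulrC.
by apply: le_trans; rewrite lerDl ltW.
Unshelve. all: by end_near.
Qed.

(** From [|x| <= 1 + x^2]; it bounds the slab position, hence [lam], as soon as [ssumsq y] is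
    bounded. *)
Lemma abs_ssum_le y : `|ssum y| <= (size y)%:R + ssumsq y.
Proof.
elim: y => [|x y ih]; first by rewrite /ssum /ssumsq !big_nil normr0 addr0.
rewrite ssum_cons ssumsq_cons /= -(natr1 (size y)).
apply: (le_trans (ler_normD _ _)).
have : `|x| <= 1 + x ^+ 2.
  rewrite -(real_normK (num_real x)); move: `|x| => a.
  by have := sqr_ge0 (a - 1); have := sqr_ge0 a; rewrite sqrrB1; lra.
by lra.
Qed.

(* With y fixed, the other n spins lie on the sphere of squared radius residual around
   their mean. *)
Definition residual (m rho : R) N n y : R :=
  (rho * N%:R - ssumsq y) - (m * N%:R - ssum y) ^+ 2 / n%:R.

Lemma residual_le (m rho : R) N n y : residual m rho N n y <= rho * N%:R - ssumsq y.
Proof. by rewrite gerBl divr_ge0 ?sqr_ge0. Qed.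

(** For [0 < j] the power vanishes wherever the residual is negative, that is for large [y], and so
    it coincides with [hpow]. *)
Lemma residual_nice k j (m rho : R) N n : (0 < j)%N ->
  nice k (fun y => Num.sqrt (residual m rho N n y) ^+ j).
Proof.
move=> j0; split.
  move=> d T X mX; apply: measurable_funX.
  apply: (measurableT_comp (@measurable_sqrt R)).
  have mS := family_ssum mX; have mQ := family_ssumsq mX.
  apply: measurable_funB; first exact: measurable_funB.
  by apply: measurable_funM => //; apply: measurable_funX; exact: measurable_funB.
exists (Num.sqrt (rho * N%:R) ^+ j * expR (rho * N%:R)), 1; split=> [|//|y _].
  by rewrite mulr_ge0 ?exprn_ge0 ?sqrtr_ge0 ?expR_ge0.
have le := residual_le m rho N n y.
rewrite ger0_norm ?exprn_ge0 ?sqrtr_ge0 // -hpowE //.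
have le' : residual m rho N n y <= rho * N%:R.
  by apply: (le_trans le); rewrite gerBl ssumsq_ge0.
apply: (le_trans (hpow_gauss j le')); rewrite -mulrA -expRD mulN1r.
by rewrite ler_wpM2l ?exprn_ge0 ?sqrtr_ge0 // ler_expR.
Qed.

Lemma shell_cat (m rho : R) N d y psi : shell m rho N d (y ++ psi) =
  iv ((`|ssum psi - (m * N%:R - ssum y)| < d) &&
      (`|ssumsq psi - (rho * N%:R - ssumsq y)| < d)).
Proof.
rewrite /shell ssum_cat ssumsq_cat /iv.
have -> : ssum y + ssum psi - m * N%:R = ssum psi - (m * N%:R - ssum y) by ring.
by have -> : ssumsq y + ssumsq psi - rho * N%:R =
  ssumsq psi - (rho * N%:R - ssumsq y) by ring.
Qed.

(** [c] is chosen before [h], because the numerator ([h] the observable) and the denominator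
    ([h = 1]) must be normalised by the same constant. *)
Lemma shell_section_cvg k i (m rho : R) N : exists2 c : R, 0 < c & forall h, subgauss k h ->
  (fun d => (c * d ^+ 2)^-1 * iint k (fun y => h y *
     iint i.+4.+1 (fun psi => shell m rho N d (y ++ psi)))) @ 0^'+ -->
  iint k (fun y => h y * Num.sqrt (residual m rho N i.+4.+1 y) ^+ i.+2).
Proof.
have [c c0 hc] := @shell_volume_bounds R i.+1.
exists c => // h sh.
pose D y := residual m rho N i.+4.+1 y.
(* For [ssumsq y >= T] and [d <= 1] both the shell section and the residual power vanish, so the
   error lives on a ball. *)
pose T := `|rho * N%:R| + 2.
have T0 : 0 < T by rewrite ltr_wpDl.
(* [lam0] bounds [2 |m N - ssum y| + 2] on that ball. [L] comes from [sqrt_pow_diff_le] on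
   [[D - lam d, D + lam d]], of length [2 lam d] and upper end at most [|rho N| + lam0]. *)
pose lam0 := 2 * (`|m * N%:R| + (k%:R + T)) + 2.
have lam00 : 0 <= lam0 by rewrite !addr_ge0 ?mulr_ge0 // addr_ge0 // addr_ge0 // ltW.
pose L := i.+2%:R / 2 * Num.sqrt (`|rho * N%:R| + lam0) ^+ i * (2 * lam0).
have L0 : 0 <= L by rewrite !mulr_ge0 ?exprn_ge0 ?sqrtr_ge0.
pose V d y := iint i.+4.+1 (fun psi => shell m rho N d (y ++ psi)).
have VE d y : V d y = shell_volume i.+4.+1 (m * N%:R - ssum y) (rho * N%:R - ssumsq y) d.
  by apply: iint_ext => psi _; exact: shell_cat.
have pt d y : 0 < d <= 1 -> size y = k ->
    `|(c * d ^+ 2)^-1 * V d y - Num.sqrt (D y) ^+ i.+2| <= L * d * iv (ssumsq y < T).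
  move=> /andP[d0 d1] sy; have cd0 : 0 < c * d ^+ 2 by rewrite mulr_gt0 ?exprn_gt0.
  rewrite /iv; case: ltP => [yT|Ty]; last first.
    have q1 : rho * N%:R - ssumsq y <= - 1.
      by have := ler_norm (rho * N%:R); move: Ty; rewrite /T; lra.
    have -> : V d y = 0.
      rewrite VE /shell_volume.
      (* The shell is empty here; its zero indicator is written as 0 times a [nice] function so that
         [iintZ] evaluates the integral. *)
      transitivity (iint i.+4.+1 (fun psi : seq R => 0 * iv ((`|ssum psi - 0| < 1) && (`|ssumsq psi - 0| < 1)))).
        apply: iint_ext => psi _; rewrite mul0r /iv; case: ifP => // /andP[_].
        have := ssumsq_ge0 psi; rewrite ltr_distl => ? /andP[_]; lra.
      by rewrite iintZ ?mul0r //; exact: shell_nice.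
    have -> : Num.sqrt (D y) = 0.
      by apply/ler0_sqrtr/(le_trans (residual_le _ _ _ _ _)); lra.
    by rewrite expr0n /= !mulr0 subrr normr0.
  pose s := m * N%:R - ssum y; pose lam := 2 * `|s| + 2.
  have lamle : lam <= lam0.
    rewrite /lam /lam0 lerD2r ler_wpM2l // (le_trans (ler_normB _ _)) // lerD2l.
    by apply: (le_trans (abs_ssum_le y)); rewrite sy lerD2l ltW.
  have lam1 : 0 <= lam by rewrite addr_ge0 ?mulr_ge0.
  have /andP[lo hi] := hc s (rho * N%:R - ssumsq y) d (D y) lam
    ltac:(by rewrite d0 d1) erefl erefl.
  have {}lo : Num.sqrt (D y - lam * d) ^+ i.+2 <= (c * d ^+ 2)^-1 * V d y.
    by rewrite VE ler_pdivlMl.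
  have {}hi : (c * d ^+ 2)^-1 * V d y <= Num.sqrt (D y + lam * d) ^+ i.+2.
    by rewrite VE ler_pdivrMl.
  have ld : 0 <= lam * d by rewrite mulr_ge0 // ltW.
  have lo' : Num.sqrt (D y - lam * d) ^+ i.+2 <= Num.sqrt (D y) ^+ i.+2.
    by rewrite lerXn2r ?nnegrE ?sqrtr_ge0 // ler_wsqrtr // gerBl.
  have hi' : Num.sqrt (D y) ^+ i.+2 <= Num.sqrt (D y + lam * d) ^+ i.+2.
    by rewrite lerXn2r ?nnegrE ?sqrtr_ge0 // ler_wsqrtr // lerDl.
  apply: (@le_trans _ _ (Num.sqrt (D y + lam * d) ^+ i.+2 - Num.sqrt (D y - lam * d) ^+ i.+2)).
    by rewrite ler_norml; lra.
  apply: (le_trans (@sqrt_pow_diff_le R i _ _ _)); first by lra.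
  have -> : D y + lam * d - (D y - lam * d) = 2 * lam * d by ring.
  rewrite mulr1 /L -[leRHS]mulrA ler_pM ?mulr_ge0 ?exprn_ge0 ?sqrtr_ge0 //.
  - exact: ltW.
  - rewrite ler_wpM2l // lerXn2r ?nnegrE ?sqrtr_ge0 // ler_wsqrtr //.
    have := residual_le m rho N i.+4.+1 y; rewrite -/(D y).
    have := ssumsq_ge0 y; have := ler_norm (rho * N%:R).
    have : lam * d <= lam by rewrite ler_piMr.
    by lra.
  - by rewrite ler_wpM2r ?(ltW d0) // ler_wpM2l.
have nV d : nice k (fun y => h y * V d y).
  have := nice_iint (nice_subgauss (subgauss_take i.+4.+1 sh) (shell_nice (k + i.+4.+1) (m * N%:R) (rho * N%:R) d)).
  apply: nice_ext => y sy; rewrite /V -iintZ; last first.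
    by apply: nice_cat; exact: shell_nice.
  by apply: iint_ext => psi _; rewrite take_size_cat.
have nD : nice k (fun y => h y * Num.sqrt (D y) ^+ i.+2).
  by apply: nice_subgauss => //; exact: residual_nice.
have nT : nice k (fun y => `|h y| * iv (ssumsq y < T)).
  apply: nice_subgauss; first exact: subgauss_norm.
  split.
    by move=> d' T' X mX; apply: measurable_iv; apply: measurable_fun_ltr => //;
      exact: family_ssumsq mX.
  exists (expR T), 1; split => // phi _; rewrite ger0_norm ?iv_ge0 // -expRD mulN1r /iv.
  by case: ltP => Qphi; rewrite ?expR_ge0 // -expR0 ler_expR subr_ge0 ltW.
apply: (@cvg_at_right_linear _ _ (L * iint k (fun y => `|h y| * iv (ssumsq y < T)))) => d d01.
rewrite -[X in X - _](iintZ _ (nV d)) -iintB //; last exact: niceZ.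
apply: (le_trans (le_norm_iint _)); first by apply: niceB => //; exact: niceZ.
rewrite mulrAC -iintZ //; apply: le_iint; [|exact: niceZ|].
  by apply: nice_norm; apply: niceB => //; exact: niceZ.
move=> y sy; rewrite [X in X - _]mulrCA -mulrBr normrM [leRHS]mulrCA.
by apply: ler_wpM2l => //; exact: pt.
Qed.

(** Numerator and denominator, each divided by [c d^2], converge separately. The assumed positivity
    of the limiting normalisation is later read off from its Gaussian approximation for large
    [N]. *)
Theorem mc_avg_marginal k i (I : 'I_k -> 'I_(k + i.+4.+1)) (f : ('I_k -> R) -> R) (m rho : R) :
  injective I -> subgauss k (on_seq f) ->
  let w y := Num.sqrt (residual m rho (k + i.+4.+1) i.+4.+1 y) ^+ i.+2 in
  0 < iint k w ->
  mc_avg m rho (k + i.+4.+1) (fun phi => f (restr I phi)) =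
  iint k (fun y => on_seq f y * w y) / iint k w.
Proof.
move=> injI sf w w0; set N := (k + i.+4.+1)%N.
have [c c0 hc] := shell_section_cvg k i m rho N.
have pshell d phi psi : perm_eq phi psi -> shell m rho N d phi = shell m rho N d psi.
  by move=> pp; rewrite /shell (perm_ssum pp) (perm_ssumsq pp).
have nshell d : nice (k + i.+4.+1) (shell m rho N d) by exact: shell_nice.
have num := hc _ sf.
have den := hc _ (subgauss_cst k 1).
have E1 : iint k (fun y => 1 * Num.sqrt (residual m rho N i.+4.+1 y) ^+ i.+2) = iint k w.
  by apply: iint_ext => y _; rewrite mul1r.
rewrite E1 in den.
pose A d := iint k (fun y => on_seq f y * iint i.+4.+1 (fun psi => shell m rho N d (y ++ psi))).
pose B d := iint k (fun y => 1 * iint i.+4.+1 (fun psi => shell m rho N d (y ++ psi))).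
have H : (fun d => ((c * d ^+ 2)^-1 * A d) / ((c * d ^+ 2)^-1 * B d)) @ 0^'+ -->
    iint k (fun y => on_seq f y * w y) / iint k w.
  by apply: cvgM => //; apply: cvgV => //; rewrite lt0r_neq0.
apply/cvg_lim => //.
refine (cvg_trans _ H); apply: near_eq_cvg; near=> d.
have d0 : 0 < d by near: d; exact: nbhs_right_gt.
have t0 : (c * d ^+ 2)^-1 != 0 by rewrite invr_neq0 // lt0r_neq0 // mulr_gt0 // exprn_gt0.
have -> : iint N (shell m rho N d) =
    iint k (fun y => 1 * iint i.+4.+1 (fun psi => shell m rho N d (y ++ psi))).
  by rewrite iint_cat; apply: iint_ext => y _; rewrite mul1r.
rewrite (iint_marginal injI sf (nshell d) (pshell d)) /=.
move: (c * d ^+ 2)^-1 t0 => t t0; rewrite -/(A d) -/(B d).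
by rewrite invfM mulrACA mulfV // mul1r.
Unshelve. all: by end_near.
Qed.

End MicrocanonicalLimit.

(** * Gaussian approximation *)

Section GaussianApproximation.
Context {R : realType}.
Implicit Types (n k : nat) (g h : seq R -> R) (y : seq R).

Lemma expRN_lipschitz (a u w : R) : a <= u -> a <= w ->
  `|expR (- u) - expR (- w)| <= `|u - w| * expR (- a).
Proof.
wlog uw : u w / u <= w => [H|] au aw.
  have [uw|wu] := leP u w; first exact: H.
  by rewrite distrC [`|u - w|]distrC; apply: H => //; exact: ltW.
have e : expR (- w) = expR (- u) * expR (- (w - u)) by rewrite -expRD; congr expR; ring.
have h1 : 1 - (w - u) <= expR (- (w - u)) by exact: expR_ge1Dx.
rewrite ger0_norm; last by rewrite subr_ge0 ler_expR lerN2.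
rewrite distrC ger0_norm ?subr_ge0 // e -{1}[expR (- u)]mulr1 -mulrBr mulrC.
rewrite ler_pM ?expR_ge0 //; last by rewrite ler_expR lerN2.
- by rewrite subr_ge0 -expR0 ler_expR oppr_le0 subr_ge0.
- by lra.
Qed.

(** Half of the decay absorbs the factor [B], through [B / 8 <= expR (B / 8)]. *)
Lemma mul_expRN_le (B : R) : 0 <= B -> B * expR (- (B / 4)) <= 8 * expR (- (B / 8)).
Proof.
move=> B0; have -> : - (B / 4) = - (B / 8) + - (B / 8) by field.
have h : B / 8 <= expR (B / 8) by have := expR_ge1Dx (B / 8); lra.
rewrite expRD mulrA ler_wpM2r ?expR_ge0 //.
have hE : expR (B / 8) * expR (- (B / 8)) = 1 by rewrite -expRD subrr expR0.
by have := ler_wpM2r (expR_ge0 (- (B / 8))) h; rewrite hE; lra.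
Qed.

(** The same trade for two factors, from the square of [B / 16 <= expR (B / 16)]; hence
    [256 = 16^2]. *)
Lemma sqr_mul_expRN_le (B : R) : 0 <= B ->
  B ^+ 2 * expR (- (B / 4)) <= 256 * expR (- (B / 8)).
Proof.
move=> B0; have -> : - (B / 4) = - (B / 8) + - (B / 8) by field.
have h : B / 16 <= expR (B / 16) by have := expR_ge1Dx (B / 16); lra.
have h2 : (B / 16) ^+ 2 <= expR (B / 8).
  have -> : B / 8 = B / 16 + B / 16 by field.
  by rewrite expRD expr2 ler_pM // divr_ge0.
rewrite expRD mulrA ler_wpM2r ?expR_ge0 //.
have hE : expR (B / 8) * expR (- (B / 8)) = 1 by rewrite -expRD subrr expR0.
by have := ler_wpM2r (expR_ge0 (- (B / 8))) h2; rewrite hE; lra.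
Qed.

Lemma sqrt_expR (x : R) : Num.sqrt (expR x) = expR (x / 2).
Proof.
have -> : expR x = expR (x / 2) ^+ 2 by rewrite expr2 -expRD; congr expR; field.
by rewrite sqrtr_sqr ger0_norm ?expR_ge0.
Qed.

Lemma sqrt_1B_pow_le j (x : R) : Num.sqrt (1 - x) ^+ j <= expR (- (j%:R * x / 2)).
Proof.
have -> : - (j%:R * x / 2) = (- x / 2) * j%:R by field.
rewrite expRM_natr -sqrt_expR lerXn2r ?nnegrE ?sqrtr_ge0 //.
exact/ler_wsqrtr/expR_ge1Dx.
Qed.

(** Amounts to [ln (1 - x) >= - x - 2 x^2] on [[0, 1/2]], obtained from [(1 - x)^-1 = 1 + x / (1 -
    x) <= expR (x / (1 - x))]. *)
Lemma sqrt_1B_pow_ge j (x : R) : 0 <= x <= 2^-1 ->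
  expR (- (j%:R * (x + 2 * x ^+ 2) / 2)) <= Num.sqrt (1 - x) ^+ j.
Proof.
move=> /andP[x0 x2]; have x1 : 0 < 1 - x by lra.
have -> : - (j%:R * (x + 2 * x ^+ 2) / 2) = (- (x + 2 * x ^+ 2) / 2) * j%:R by field.
rewrite expRM_natr -sqrt_expR lerXn2r ?nnegrE ?sqrtr_ge0 // ler_wsqrtr //.
have h : (1 - x)^-1 <= expR (x / (1 - x)).
  have e : (1 - x)^-1 = 1 + x / (1 - x) by field; exact: lt0r_neq0.
  by rewrite [leLHS]e; exact: expR_ge1Dx.
have h2 : expR (x / (1 - x)) <= expR (x + 2 * x ^+ 2).
  have x12 : 0 <= 1 - 2 * x by lra.
  rewrite ler_expR ler_pdivrMr // -subr_ge0.
  have -> : (x + 2 * x ^+ 2) * (1 - x) - x = x ^+ 2 * (1 - 2 * x) by ring.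
  by rewrite mulr_ge0 ?sqr_ge0.
by rewrite expRN invf_ple ?posrE ?expR_gt0 // (le_trans h).
Qed.

(** The power lies between [expR (- v)] and [expR (- u)], where [u] and [v] differ from [B / 2] by
    at most a multiple of [(B + B^2) / N]. All exponents are at least [B / 4], so the polynomial
    factors are absorbed at the price of the slower decay [B / 8]. In the constant,
    [1056 = 4 * 256 + 4 * 8]: the first term is for [4 B^2], the second for the case [x > 1/2]. *)
Lemma pow_gauss_close j (A B N n K kap : R) :
  0 <= B -> B <= A -> A <= 2 * B -> n * (A - B) <= K * B -> j%:R <= n ->
  0 <= kap -> N = j%:R + kap -> N <= 2 * j%:R -> 0 < N -> 0 <= K ->
  `|Num.sqrt (1 - A / N) ^+ j - expR (- (B / 2))| <=
  (8 * (kap + K) + 1056) / N * expR (- (B / 8)).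
Proof.
move=> B0 BA A2B nAB jn kap0 NE N2j N0 K0.
have A0 : 0 <= A by exact: le_trans BA.
have [x xE] : exists x, x = A / N by exists (A / N).
have [u uE] : exists u, u = j%:R * x / 2 by exists (j%:R * x / 2).
have x0 : 0 <= x by rewrite xE divr_ge0 // ltW.
have xN : x * N = A by rewrite xE mulfVK // lt0r_neq0.
have p0 : 0 <= Num.sqrt (1 - x) ^+ j by rewrite exprn_ge0 ?sqrtr_ge0.
have pu := sqrt_1B_pow_le j x; rewrite -uE in pu.
have uB : B / 4 <= u.
  have : A <= 2 * j%:R * x by rewrite -xN mulrC ler_wpM2r.
  by rewrite uE; lra.
have wB : B / 4 <= B / 2 by lra.
have e4 : expR (- u) <= expR (- (B / 4)) by rewrite ler_expR lerN2.
have e2 : expR (- (B / 2)) <= expR (- (B / 4)) by rewrite ler_expR lerN2.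
have z0 := expR_gt0 (- (B / 8)).
have b1 := mul_expRN_le B0; have b2 := sqr_mul_expRN_le B0.
have e0 := expR_gt0 (- (B / 2)).
have e40 := expR_gt0 (- (B / 4)).
rewrite mulrAC ler_pdivlMr // -xE.
(* If [x > 1/2] then [N <= 2 A <= 4 B]: the decay in [B] alone pays for the factor [N]. *)
have [x12|x12] := leP x 2^-1; last first.
  have d1 : `|Num.sqrt (1 - x) ^+ j - expR (- (B / 2))| <= expR (- (B / 4)).
    by rewrite ler_norml; lra.
  have N4 : N <= 4 * B by move: xN; nra.
  apply: (@le_trans _ _ (expR (- (B / 4)) * (4 * B))).
    by rewrite ler_pM // ltW.
  have : 0 <= (kap + K) * expR (- (B / 8)) by rewrite mulr_ge0 ?addr_ge0 // ltW.
  by lra.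
have [v vE] : exists v, v = j%:R * (x + 2 * x ^+ 2) / 2 by eexists.
have pv : expR (- v) <= Num.sqrt (1 - x) ^+ j by rewrite vE; apply: sqrt_1B_pow_ge; rewrite x0.
have uv : u <= v.
  rewrite -subr_ge0 (_ : v - u = j%:R * x ^+ 2) ?mulr_ge0 ?sqr_ge0 //.
  by rewrite vE uE; field.
have vuN : (v - u) * N <= 4 * B ^+ 2.
  have -> : (v - u) * N = j%:R * (x * (x * N)) by rewrite vE uE; field.
  rewrite xN; apply: (@le_trans _ _ (N * (x * A))).
    by rewrite ler_wpM2r ?mulr_ge0 // NE lerDl.
  rewrite mulrA [N * x]mulrC xN -expr2.
  have -> : 4 * B ^+ 2 = (2 * B) ^+ 2 by ring.
  by rewrite lerXn2r ?nnegrE // mulr_ge0.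
have uwN : `|u - B / 2| * N <= (kap + K) * B / 2.
  rewrite -[X in _ * X](ger0_norm (ltW N0)) -normrM.
  have -> : (u - B / 2) * N = (j%:R * (A - B) - kap * B) / 2.
    by rewrite uE -xN NE; field.
  have h1 : j%:R * (A - B) <= K * B.
    by apply: le_trans nAB; rewrite ler_wpM2r // subr_ge0.
  have h2 : 0 <= j%:R * (A - B) by rewrite mulr_ge0 // subr_ge0.
  have h3 : 0 <= kap * B by rewrite mulr_ge0.
  have h4 : 0 <= K * B by rewrite mulr_ge0.
  by rewrite ler_norml; lra.
have l1 := expRN_lipschitz uB wB.
have l2 := expRN_lipschitz (le_trans uB uv) wB.
have tri : `|v - B / 2| <= (v - u) + `|u - B / 2|.
  have -> : v - B / 2 = (v - u) + (u - B / 2) by ring.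
  by rewrite (le_trans (ler_normD _ _)) // (ger0_norm (_ : 0 <= v - u)) // subr_ge0.
have d1 : `|Num.sqrt (1 - x) ^+ j - expR (- (B / 2))| <=
    (2 * `|u - B / 2| + (v - u)) * expR (- (B / 4)).
  have n1 := normr_ge0 (expR (- u) - expR (- (B / 2))).
  have n2 := normr_ge0 (expR (- v) - expR (- (B / 2))).
  have a1 := ler_norm (expR (- u) - expR (- (B / 2))).
  have a2 := ler_norm (- (expR (- v) - expR (- (B / 2)))); rewrite normrN in a2.
  have t2 : `|v - B / 2| * expR (- (B / 4)) <=
      ((v - u) + `|u - B / 2|) * expR (- (B / 4)) by rewrite ler_wpM2r // ltW.
  by rewrite ler_norml; lra.
apply: (@le_trans _ _ ((2 * `|u - B / 2| + (v - u)) * N * expR (- (B / 4)))).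
  by rewrite mulrAC ler_wpM2r // ltW.
have c1 : (2 * `|u - B / 2| + (v - u)) * N * expR (- (B / 4)) <=
    ((kap + K) * B + 4 * B ^+ 2) * expR (- (B / 4)).
  by rewrite ler_wpM2r ?(ltW e40) //; lra.
have c2 : (kap + K) * (B * expR (- (B / 4))) <= (kap + K) * (8 * expR (- (B / 8))).
  by rewrite ler_wpM2l ?addr_ge0.
by lra.
Qed.

(** The threshold on [N] forces [bN >= b / 2]. The conclusion [0 < bN] supplies the positivity that
    [mc_avg_marginal] asks for. *)
Lemma ratio_close (a b alpha beta : R) : 0 < b -> 0 <= alpha -> 0 <= beta ->
  exists C : R, forall N aN bN : R, 0 < N -> 2 * beta / b <= N ->
    `|aN - a| <= alpha / N -> `|bN - b| <= beta / N ->
    0 < bN /\ `|aN / bN - a / b| <= C / N.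
Proof.
move=> b0 al0 be0; exists (2 * (alpha * b + `|a| * beta) / b ^+ 2) => N aN bN N0 Nb ha hb.
have hb2 : beta / N <= b / 2.
  by move: Nb; rewrite !ler_pdivrMr //; lra.
have bN0 : b / 2 <= bN.
  by have := le_trans hb hb2; rewrite ler_norml; lra.
have bNp : 0 < bN by apply: lt_le_trans bN0; rewrite divr_gt0.
split => //.
have -> : aN / bN - a / b = ((aN - a) * b - a * (bN - b)) / (bN * b).
  by field; rewrite !lt0r_neq0.
rewrite normrM normfV [`|bN * b|]ger0_norm; last by rewrite mulr_ge0 // ltW.
rewrite ler_pdivrMr ?mulr_gt0 //.
apply: (@le_trans _ _ ((alpha * b + `|a| * beta) / N)).
  rewrite (le_trans (ler_normB _ _)) // [leRHS]mulrDl !normrM lerD //.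
    by rewrite (ger0_norm (ltW b0)) mulrAC ler_wpM2r // ltW.
  by rewrite -mulrA ler_wpM2l.
have s0 : 0 <= (alpha * b + `|a| * beta) / N.
  by rewrite divr_ge0 ?(ltW N0) // addr_ge0 // mulr_ge0 // ltW.
have -> : 2 * (alpha * b + `|a| * beta) / b ^+ 2 / N * (bN * b) =
   (alpha * b + `|a| * beta) / N * (2 * bN / b) by field; rewrite !lt0r_neq0.
by rewrite ler_peMr // ler_pdivlMr //; lra.
Qed.

Definition centered (m : R) y : seq R := [seq x - m | x <- y].

Lemma ssum_centered m y : ssum (centered m y) = ssum y - (size y)%:R * m.
Proof.
elim: y => [|x y ih]; first by rewrite /= /ssum !big_nil mul0r subr0.
by rewrite /= !ssum_cons ih -(natr1 (size y)); ring.
Qed.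

Lemma ssumsq_centered m y :
  ssumsq (centered m y) = ssumsq y - 2 * m * ssum y + (size y)%:R * m ^+ 2.
Proof.
elim: y => [|x y ih].
  by rewrite /= /ssum /ssumsq !big_nil mulr0 mul0r subr0 addr0.
by rewrite /= !ssumsq_cons ssum_cons ih -(natr1 (size y)); ring.
Qed.

(** Each step uses [(x + S)^2 <= 2 x^2 + 2 S^2]. Any factor depending on the length alone suffices,
    since the length is the fixed [k]. *)
Lemma sqr_ssum_le y : ssum y ^+ 2 <= 2 ^+ size y * ssumsq y.
Proof.
elim: y => [|x y ih]; first by rewrite /ssum /ssumsq !big_nil expr0n mulr0.
rewrite ssum_cons ssumsq_cons /= (exprS _ (size y)).
have := sqr_ge0 (x - ssum y).
have : x ^+ 2 <= 2 ^+ size y * x ^+ 2 by rewrite ler_peMl ?sqr_ge0 // exprn_ege1 // ler1n.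
by rewrite sqrrB sqrrD; lra.
Qed.

(** With [z = y - m] and [N = k + n] one has [m N - sum y = m n - sum z], and its terms linear in
    [sum z] cancel those of [|y|^2]. *)
Lemma residual_centered k i (m rho : R) y : size y = k ->
  residual m rho (k + i.+4.+1) i.+4.+1 y =
  (rho - m ^+ 2) * (k + i.+4.+1)%:R - ssumsq (centered m y)
    - ssum (centered m y) ^+ 2 / i.+4.+1%:R.
Proof.
move=> s; rewrite /residual ssum_centered ssumsq_centered s natrD.
have : i.+4.+1%:R != 0 :> R by rewrite pnatr_eq0.
by move: (i.+4.+1%:R : R) (k%:R : R) => n k' n0; field.
Qed.

(** Completing the square: these parameters are those of independent Gaussians of mean [m] and
    variance [v]. *)
Lemma gc_weight_centered (m v : R) y : v != 0 ->
  gc_weight (- (m / v)) (2 * v)^-1 y =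
  expR ((size y)%:R * m ^+ 2 / (2 * v)) * expR (- (ssumsq (centered m y) / v / 2)).
Proof.
by move=> v0; rewrite -expRD ssumsq_centered /gc_weight; congr expR; field.
Qed.

End GaussianApproximation.

(** * Fixed magnetisation *)

Section EquivalenceAtFixedMagnetisation.
Context {R : realType}.
Implicit Types (n k : nat) (g h : seq R -> R) (y : seq R).

Lemma centered_gauss_nice k (m v c : R) : 0 < v -> 0 < c ->
  nice k (fun y => expR (- (ssumsq (centered m y) / v / c))).
Proof.
move=> v0 c0; pose v' := v * c / 2.
have v'0 : 0 < v' by rewrite !mulr_gt0.
apply: (@nice_ext _ _ (fun y => (expR (k%:R * m ^+ 2 / (2 * v')))^-1 *
    gc_weight (- (m / v')) (2 * v')^-1 y)) => [y s|].
  rewrite gc_weight_centered ?lt0r_neq0 // s mulKf ?lt0r_neq0 ?expR_gt0 //.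
  by congr expR; rewrite /v'; field; rewrite !lt0r_neq0.
by apply: niceZ; apply: gc_weight_nice; rewrite invr_gt0 mulr_gt0.
Qed.

(** Instance of [pow_gauss_close] with [B = |z|^2 / v], [n = i + 5], [j = n - 3], [kap = k + 3], and
    [K = 2^k] from [sqr_ssum_le]. Here [k < i] yields [N <= 2 j] and [2^k <= i] yields [A <= 2 B].
    The prefactor does not depend on [y] and cancels in ratios. *)
Lemma residual_pow_close k i (m rho : R) (N := (k + i.+4.+1)%N)
    (v := rho - m ^+ 2) y :
  m ^+ 2 < rho -> size y = k -> (k < i)%N -> (2 ^ k <= i)%N ->
  `| (Num.sqrt (v * N%:R) ^+ i.+2)^-1 * Num.sqrt (residual m rho N i.+4.+1 y) ^+ i.+2
     - expR (- (ssumsq (centered m y) / v / 2))| <=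
  (8 * (k%:R + 3 + 2 ^+ k) + 1056) / N%:R * expR (- (ssumsq (centered m y) / v / 8)).
Proof.
move=> mrho s ki Ki; have v0 : 0 < v by rewrite subr_gt0.
pose n : R := i.+4.+1%:R.
have N0 : 0 < N%:R :> R by rewrite ltr0n /N addnS.
have n0 : 0 < n by rewrite ltr0n.
have Kn : 2 ^+ k <= n by rewrite -natrX ler_nat; clear -Ki; lia.
have Kn1 : (2 ^+ k : R) / n <= 1 by rewrite ler_pdivrMr ?mul1r.
set Q := ssumsq (centered m y); set S := ssum (centered m y).
have Q0 : 0 <= Q by exact: ssumsq_ge0.
have SQ : S ^+ 2 <= 2 ^+ k * Q.
  by have := sqr_ssum_le (centered m y); rewrite size_map s.
have Sn0 : 0 <= S ^+ 2 / n / v by rewrite !divr_ge0 ?sqr_ge0 // ltW.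
have K0 : 0 <= (2 ^+ k : R) by rewrite exprn_ge0.
pose A := Q / v + S ^+ 2 / n / v.
have -> : (Num.sqrt (v * N%:R) ^+ i.+2)^-1 * Num.sqrt (residual m rho N i.+4.+1 y) ^+ i.+2 =
    Num.sqrt (1 - A / N%:R) ^+ i.+2.
  have -> : residual m rho N i.+4.+1 y = v * N%:R * (1 - A / N%:R).
    rewrite residual_centered // -/Q -/S -/v -/N -/n /A.
    by field; rewrite !lt0r_neq0.
  rewrite [Num.sqrt (_ * (1 - _))]sqrtrM; last by rewrite mulr_ge0 // ltW.
  rewrite exprMn mulKf // expf_neq0 // lt0r_neq0 // sqrtr_gt0 mulr_gt0 //.
have SQv : S ^+ 2 / n / v * n <= 2 ^+ k * (Q / v).
  have -> : S ^+ 2 / n / v * n = S ^+ 2 / v by field; rewrite !lt0r_neq0.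
  by rewrite mulrA ler_wpM2r // invr_ge0 ltW.
have j0 : (i.+2%:R : R) <= n by rewrite ler_nat; clear; lia.
apply: (@pow_gauss_close R i.+2 A (Q / v) N%:R n) => //.
- by rewrite divr_ge0 // ltW.
- by rewrite lerDl.
- have h1 : S ^+ 2 / n / v <= 2 ^+ k / n * (Q / v).
    by rewrite [leRHS]mulrAC ler_pdivlMr.
  have h2 : 2 ^+ k / n * (Q / v) <= Q / v by rewrite ler_piMl // divr_ge0 // ltW.
  by rewrite mulr_natl mulr2n lerD2l (le_trans h1).
- by rewrite /A addrC addKr mulrC.
- have -> : N = (i.+2 + (k + 3))%N by rewrite /N; clear; lia.
  by rewrite !natrD.
- have : (N <= 2 * i.+2)%N by rewrite /N; clear -ki; lia.
  by rewrite -(ler_nat R) natrM.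
Qed.

(** [G], the [k]-site Gaussian average, is fixed before [N] and [I]. Besides the comparison, this
    shows that the microcanonical averages stay bounded in [N], as needed for the suppressed
    branch. *)
Lemma mc_avg_gaussian k (f : ('I_k -> R) -> R) (m rho : R) :
  m ^+ 2 < rho -> subgauss k (on_seq f) ->
  exists G C : R, exists N0 : nat, forall N (I : 'I_k -> 'I_N), (N0 <= N)%N -> injective I ->
    gc_avg (- (m / (rho - m ^+ 2))) (2 * (rho - m ^+ 2))^-1 N (fun phi => f (restr I phi)) = G /\
    `|mc_avg m rho N (fun phi => f (restr I phi)) - G| <= C / N%:R.
Proof.
move=> mrho sf; set v := rho - m ^+ 2.
have v0 : 0 < v by rewrite subr_gt0.
have vn0 : v != 0 by exact: lt0r_neq0.
have e0 : 0 < (2 * v)^-1 by rewrite invr_gt0 mulr_gt0.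
pose gw := gc_weight (- (m / v)) (2 * v)^-1.
pose om y := expR (- (ssumsq (centered m y) / v / 2)).
pose z y := expR (- (ssumsq (centered m y) / v / 8)).
have nom : nice k om by exact: centered_gauss_nice.
have nz : nice k z by exact: centered_gauss_nice.
pose E0 := expR (k%:R * m ^+ 2 / (2 * v)).
have E00 : E0 != 0 by rewrite lt0r_neq0 // expR_gt0.
have gwE y : size y = k -> gw y = E0 * om y.
  by move=> s; rewrite /gw gc_weight_centered // s.
have gwi h : subgauss k h -> iint k (fun y => h y * gw y) = E0 * iint k (fun y => h y * om y).
  move=> sh; rewrite -iintZ; last exact: nice_subgauss.
  by apply: iint_ext => y s; rewrite gwE // mulrCA.
pose F := on_seq f.
pose a := iint k (fun y => F y * om y).
pose b := iint k (fun y => 1 * om y).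
have s1 := @subgauss_cst R k 1.
have gw1 : iint k gw = iint k (fun y => 1 * gw y).
  by apply: iint_ext => y _; rewrite mul1r.
have b0 : 0 < b.
  have := iint_gc_weight_gt0 k (- (m / v)) e0.
  by rewrite -/gw gw1 gwi // pmulr_rgt0 ?expR_gt0.
pose c1 : R := 8 * (k%:R + 3 + 2 ^+ k) + 1056.
have c10 : 0 <= c1.
  have : 0 <= (2 ^+ k : R) by rewrite exprn_ge0.
  by have := ler0n R k; rewrite /c1; lra.
pose err h := c1 * iint k (fun y => `|h y| * z y).
have err0 h : 0 <= err h.
  by rewrite mulr_ge0 //; apply: iint_ge0 => y _; rewrite mulr_ge0 ?expR_ge0.
have [C HC] := @ratio_close R a b (err F) (err (fun=> 1)) b0 (err0 _) (err0 _).
pose e1 : R := 2 * err (fun=> 1) / b.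
(* With [i = N - k - 5] the threshold ensures [k < i], [2^k <= i] and [e1 <= N], the last being the
   condition of [ratio_close]. *)
exists (a / b), C, (k + (k + 2 ^ k + Num.bound e1 + 6))%N.
move=> N I NN injI.
have [i iE] : exists i, N = (k + i.+4.+1)%N by exists (N - k - 5)%N; clear -NN; lia.
move: I injI NN; rewrite {N}iE => I injI NN; set N := (k + i.+4.+1)%N.
split.
  by rewrite gc_avg_marginal // -/gw gw1 !gwi // invfM mulrACA mulfV ?mul1r.
have ki : (k < i)%N by clear -NN; lia.
have Ki : (2 ^ k <= i)%N by clear -NN; lia.
have N0 : 0 < N%:R :> R by rewrite ltr0n /N addnS.
pose w y := Num.sqrt (residual m rho N i.+4.+1 y) ^+ i.+2.
pose sN := Num.sqrt (v * N%:R) ^+ i.+2.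
have sN0 : 0 < sN by rewrite exprn_gt0 // sqrtr_gt0 mulr_gt0.
have sNn0 : sN != 0 by exact: lt0r_neq0.
pose p y := sN^-1 * w y.
have np : nice k p by apply: niceZ; exact: residual_nice.
have close h : subgauss k h ->
    `|iint k (fun y => h y * p y) - iint k (fun y => h y * om y)| <= err h / N%:R.
  move=> sh; have nhp := nice_subgauss sh np; have nho := nice_subgauss sh nom.
  have nhz := nice_subgauss (subgauss_norm sh) nz.
  rewrite -iintB // /err mulrAC -iintZ //.
  apply: (le_trans (le_norm_iint (niceB nhp nho))).
  apply: le_iint; [exact: nice_norm (niceB nhp nho)|exact: niceZ|].
  move=> y sy; rewrite -mulrBr normrM [leRHS]mulrCA ler_wpM2l //.
  exact: residual_pow_close.
have [|bN0 ab] := HC N%:R (iint k (fun y => F y * p y)) (iint k (fun y => 1 * p y)) N0 _ (close _ sf) (close _ s1).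
  have x0 : 0 <= e1 by rewrite divr_ge0 ?(ltW b0) // mulr_ge0.
  by apply: (le_trans (ltW (archi_boundP x0))); rewrite ler_nat /N; clear -NN; lia.
have pw h : subgauss k h -> iint k (fun y => h y * p y) = sN^-1 * iint k (fun y => h y * w y).
  move=> sh; rewrite -iintZ; last by apply: nice_subgauss => //; exact: residual_nice.
  by apply: iint_ext => y _; rewrite mulrCA.
have w1 : iint k w = iint k (fun y => 1 * w y) by apply: iint_ext => y _; rewrite mul1r.
have wp : 0 < iint k w by move: bN0; rewrite pw // pmulr_rgt0 ?invr_gt0 // w1.
have cancel (t x x' : R) : t != 0 -> t * x / (t * x') = x / x'.
  by move=> t0; rewrite -mulf_div divff // mul1r.
rewrite mc_avg_marginal // -/N -/w; move: ab; rewrite !pw // -w1.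
by rewrite cancel // invr_neq0.
Qed.

End EquivalenceAtFixedMagnetisation.

(** * Observables *)

Section Observables.
Context {R : realType}.
Implicit Types (n k : nat) (y : seq R).

Lemma ssumsq_ord k y : size y = k -> ssumsq y = \sum_(j < k) y`_j ^+ 2.
Proof. by move=> <-; rewrite /ssumsq (big_nth 0) big_mkord. Qed.

Lemma pow_le_expR n (t : R) : 0 <= t -> (t / n%:R) ^+ n <= expR t.
Proof.
move=> t0; case: n => [|n]; first by rewrite expr0 -expR0 ler_expR.
have -> : expR t = expR (t / n.+1%:R) ^+ n.+1.
  by rewrite -expRM_natr mulfVK // pnatr_eq0.
rewrite lerXn2r ?nnegrE ?expR_ge0 ?divr_ge0 //.
by apply: le_trans (expR_ge1Dx _); rewrite lerDr.
Qed.

(** [a <= 1 + a^2] at [a = |x|^n] passes to an even power, and [(t / n)^n <= expR t] at [t = c x^2]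
    bounds it; hence [(n / c)^n] in the constant. *)
Lemma pow_gauss_le n (c : R) : 0 < c -> exists K : R, 1 <= K /\
  forall x, `|x| ^+ n <= K * expR (c * x ^+ 2).
Proof.
move=> c0; exists (1 + (n%:R / c) ^+ n); split.
  by rewrite lerDl exprn_ge0 // divr_ge0 // ltW.
move=> x.
have h1 (u : R) : u <= 1 + u ^+ 2.
  by have := sqr_ge0 u; have := sqr_ge0 (u - 1); rewrite sqrrB1; lra.
apply: (le_trans (h1 _)).
have t0 : 0 <= c * x ^+ 2 by rewrite mulr_ge0 ?sqr_ge0 // ltW.
have e1 : 1 <= expR (c * x ^+ 2) by rewrite -expR0 ler_expR.
have h2 : (`|x| ^+ n) ^+ 2 <= (n%:R / c) ^+ n * expR (c * x ^+ 2).
  have -> : (`|x| ^+ n) ^+ 2 = (x ^+ 2) ^+ n by rewrite exprAC real_normK ?num_real.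
  have [n0|n0] := posnP n; first by rewrite n0 !expr0 mul1r.
  have -> : (x ^+ 2) ^+ n = (n%:R / c) ^+ n * (c * x ^+ 2 / n%:R) ^+ n.
    have nn : n%:R != 0 :> R by rewrite pnatr_eq0 -lt0n.
    by rewrite -exprMn; congr (_ ^+ _); field; rewrite nn lt0r_neq0.
  by rewrite ler_wpM2l ?pow_le_expR // exprn_ge0 // divr_ge0 // ltW.
by rewrite mulrDl mul1r; lra.
Qed.

Lemma subgauss_monomial k (f : ('I_k -> R) -> R) : coord_monomial f -> subgauss k (on_seq f).
Proof.
move=> [a fE]; split.
  move=> d T X [sX mX]; under eq_fun do rewrite /on_seq fE.
  by apply: measurable_prod => j _; apply: measurable_funX.
move=> c c0; pose K j := projT1 (cid (pow_gauss_le (a j) c0)).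
have HK j : 1 <= K j /\ forall x, `|x| ^+ a j <= K j * expR (c * x ^+ 2).
  exact: projT2 (cid (pow_gauss_le (a j) c0)).
exists (\prod_(j < k) K j); split.
  by apply: prodr_ge0 => j _; apply: le_trans (HK j).1.
move=> y s; rewrite /on_seq fE normr_prod (ssumsq_ord s) mulr_sumr expR_sum -big_split /=.
by apply: ler_prod => j _; rewrite normr_ge0 normrX (HK j).2.
Qed.

(** Boundedness gives the growth condition, the Lipschitz property gives measurability. *)
Lemma subgauss_lipschitz k (f : ('I_k -> R) -> R) :
  bounded_1lipschitz f -> subgauss k (on_seq f).
Proof.
move=> [[B fB] fL]; split; last first.
  move=> c c0; exists B; split.
    by apply: le_trans (fB (fun=> 0)).
  move=> y _; apply: (le_trans (fB _)); rewrite ler_peMr //.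
    by apply: le_trans (fB (fun=> 0)).
  by rewrite -expR0 ler_expR mulr_ge0 ?ssumsq_ge0 // ltW.
move=> d T X [sX mX] mT; apply: (measurability _ (RGenOInfty.measurableE R)) => //.
move=> /= _ [_ [x ->] <-].
pose qv (q : {ffun 'I_k -> rat}) (j : 'I_k) : R := ratr (q j).
pose dist (q : {ffun 'I_k -> rat}) t := Num.sqrt (\sum_(j < k) ((X t)`_j - qv q j) ^+ 2).
(* A Lipschitz f is the supremum of the cones f q - |. - q| with rational vertices. *)
rewrite (_ : _ `&` _ = \bigcup_(q in [set: {ffun 'I_k -> rat}])
    [set t | x < f (qv q) - dist q t]); last first.
  rewrite setTI; apply/seteqP; split => [t|t [q _]] /=; rewrite in_itv /= andbT.
    rewrite /on_seq; set y := fun j : 'I_k => (X t)`_j => xf.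
    (* A rational vertex within [e] in each coordinate is at distance at most [(k+1) e], a quarter
       of the gap [f y - x]. The cone loses one quarter through [f q] and one through the distance,
       so it still exceeds [x]. *)
    have [e eE] : exists e, e = (f y - x) / 4 / k.+1%:R by eexists.
    have e0 : 0 < e by rewrite eE !divr_gt0 ?subr_gt0 // ltr0n.
    have hq j : exists q : rat, `|y j - ratr q| < e.
      have : y j - e < y j + e by lra.
      case/rat_in_itvoo => q; rewrite inE /= => /itvP hq; exists q.
      by rewrite distrC ltr_distl !hq.
    pose q := [ffun j => projT1 (cid (hq j))].
    have Hq j : `|y j - qv q j| < e by rewrite /qv ffunE; exact: projT2 (cid (hq j)).
    exists q => //=.
    have dq : dist q t <= k.+1%:R * e.
      have ke0 : 0 <= k.+1%:R * e by rewrite mulr_ge0 // ltW.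
      rewrite -(ger0_norm ke0) -sqrtr_sqr ler_wsqrtr //.
      apply: (@le_trans _ _ (\sum_(j < k) e ^+ 2)).
        apply: ler_sum => j _; rewrite -(real_normK (num_real (_ - _))).
        by rewrite lerXn2r ?nnegrE ?(ltW e0) //; exact: ltW (Hq j).
      rewrite sumr_const card_ord -[leLHS]mulr_natl exprMn ler_wpM2r ?sqr_ge0 //.
      by rewrite -natrX ler_nat; nia.
    have := fL y (qv q); rewrite -/(dist q t) ler_norml => /andP[h1 h2].
    have e2 : k.+1%:R * e = (f y - x) / 4 by rewrite eE mulrC mulfVK // pnatr_eq0.
    by lra.
  move=> xq; apply: (lt_le_trans xq).
  have := fL (fun j : 'I_k => (X t)`_j) (qv q); rewrite -/(dist q t) ler_norml /on_seq.
  by lra.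
apply: countable_bigcupT_measurable => [|q]; first exact: countableP.
rewrite -[X in measurable X]setTI.
suff m : measurable_fun setT (fun t => x < f (qv q) - dist q t) by exact: (m measurableT [set true]).
apply: measurable_fun_ltr => //; apply: measurable_funB => //.
apply: (measurableT_comp (@measurable_sqrt R)).
by apply: measurable_sum => j; apply: measurable_funX; apply: measurable_funB.
Qed.

End Observables.

(** * Fixed energy *)

Section FixedEnergy.
Context {R : realType}.

Lemma Z_MC_sqrt (m rho : R) N : m ^+ 2 < rho -> (3 <= N)%N ->
  Z_MC m rho N = Num.sqrt (rho - m ^+ 2) ^+ (N - 3).
Proof.
move=> mrho N3; have v0 : 0 <= rho - m ^+ 2 by rewrite subr_ge0 ltW.
rewrite /Z_MC -natrB // mulrC powRrM powR12_sqrt // powR_mulrn // sqrtr_ge0.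
Qed.

Lemma Bernoulli_inequality n (x : R) : 0 <= x -> 1 + n%:R * x <= (1 + x) ^+ n.
Proof.
move=> x0; elim: n => [|n ih]; first by rewrite mul0r addr0.
rewrite exprS; apply: (@le_trans _ _ ((1 + x) * (1 + n%:R * x))).
  have : 0 <= n%:R * x ^+ 2 by rewrite mulr_ge0 ?sqr_ge0.
  by rewrite -(natr1 n); move: (n%:R : R) => N; nra.
by rewrite ler_wpM2l // addr_ge0.
Qed.

(** Bernoulli for [1 / q] weakens geometric decay to [C / N]. The condition [4 <= N] gives
    [N - 3 >= N / 4], and a nonzero exponent in the case [q = 0]. *)
Lemma pow_le_inv (q : R) : 0 <= q < 1 -> exists C : R, 0 <= C /\
  forall N, (4 <= N)%N -> q ^+ (N - 3) <= C / N%:R.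
Proof.
move=> /andP[q0 q1]; have [->|qn0] := eqVneq q 0.
  exists 0; split => // N N4; rewrite mul0r expr0n; case: eqP => //; lia.
have qp : 0 < q by rewrite lt0r qn0.
pose x := q^-1 - 1.
have x0 : 0 < x by rewrite subr_gt0 invf_gt1.
exists (4 / x); split; first by rewrite divr_ge0 // ltW.
move=> N N4; have N0 : 0 < N%:R :> R by rewrite ltr0n; lia.
have := Bernoulli_inequality (N - 3) (ltW x0).
have -> : 1 + x = q^-1 by rewrite /x addrC subrK.
rewrite exprVn => hB.
have qN0 : 0 < q ^+ (N - 3) by rewrite exprn_gt0.
have h : N%:R * x / 4 <= (q ^+ (N - 3))^-1.
  apply: le_trans hB.
  have : N%:R / 4 <= (N - 3)%:R :> R.
    by rewrite ler_pdivrMr // -natrM ler_nat; lia.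
  move=> h; apply: (@le_trans _ _ ((N - 3)%:R * x)); last by rewrite lerDr.
  by rewrite mulrAC ler_wpM2r // ltW.
have Nx0 : 0 < N%:R * x / 4 by rewrite !mulr_gt0 // invr_gt0.
have -> : 4 / x / N%:R = (N%:R * x / 4)^-1 by field; rewrite !lt0r_neq0.
by rewrite -[leLHS]invrK lef_pV2 // posrE ?invr_gt0.
Qed.

(** [e] bounds the relative weight of the second branch, about whose average only a bound [M] is
    used. *)
Lemma weighted_close (Z1 Z2 A1 A2 G e M del : R) : 0 < Z1 -> 0 <= Z2 -> Z2 <= Z1 * e -> 0 <= e ->
  `|A1 - G| <= del -> `|A2| <= M ->
  `|(Z1 * A1 + Z2 * A2) / (Z1 + Z2) - G| <= del + e * (M + `|G|).
Proof.
move=> z1 z2 z21 e0 h1 h2; have z12 : 0 < Z1 + Z2 by rewrite ltr_wpDr.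
have -> : (Z1 * A1 + Z2 * A2) / (Z1 + Z2) - G = (Z1 * (A1 - G) + Z2 * (A2 - G)) / (Z1 + Z2).
  by field; exact: lt0r_neq0.
rewrite normrM normfV (ger0_norm (ltW z12)) ler_pdivrMr //.
apply: (le_trans (ler_normD _ _)); rewrite !normrM (ger0_norm (ltW z1)) (ger0_norm z2).
have h3 : `|A2 - G| <= M + `|G| by rewrite (le_trans (ler_normB _ _)) // lerD2r.
have MG : 0 <= M + `|G| by exact: le_trans h3.
have d0 : 0 <= del by exact: le_trans h1.
apply: (@le_trans _ _ (Z1 * del + Z1 * e * (M + `|G|))).
  by rewrite lerD ?ler_wpM2l ?(ltW z1) // ler_pM.
have -> : (del + e * (M + `|G|)) * (Z1 + Z2) =
  Z1 * del + Z1 * e * (M + `|G|) + Z2 * (del + e * (M + `|G|)) by ring.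
by rewrite lerDl mulr_ge0 // addr_ge0 // mulr_ge0.
Qed.

Lemma le_inv_sqrt (C : R) N : (0 < N)%N -> C / N%:R <= `|C| / Num.sqrt N%:R.
Proof.
move=> N0; have N0' : 0 < N%:R :> R by rewrite ltr0n.
have s0 : 0 < Num.sqrt N%:R :> R by rewrite sqrtr_gt0.
apply: (@le_trans _ _ (`|C| / N%:R)); first by rewrite ler_wpM2r ?invr_ge0 ?ler_norm // ltW.
rewrite ler_wpM2l // lef_pV2 ?posrE //.
have s1 : Num.sqrt 1 <= Num.sqrt N%:R :> R by apply: ler_wsqrtr; rewrite ler1n.
rewrite sqrtr1 in s1.
by rewrite -{2}(sqr_sqrtr (ltW N0')) expr2 ler_peMr // ltW.
Qed.

(** The weight ratio is [(b / a)^(N-3)] with [b < a], because the root of larger modulus leaves less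
    variance. The average on that branch is bounded, being close to its own Gaussian value [G']. *)
Lemma two_branches_close k (f : ('I_k -> R) -> R) (m m' rho : R) :
  m ^+ 2 < m' ^+ 2 -> m' ^+ 2 < rho -> subgauss k (on_seq f) ->
  exists C : R, exists N0 : nat, forall N (I : 'I_k -> 'I_N), (N0 <= N)%N -> injective I ->
    `|(Z_MC m rho N * mc_avg m rho N (fun phi => f (restr I phi)) +
       Z_MC m' rho N * mc_avg m' rho N (fun phi => f (restr I phi)))
        / (Z_MC m rho N + Z_MC m' rho N)
      - gc_avg (- (m / (rho - m ^+ 2))) (2 * (rho - m ^+ 2))^-1 N
          (fun phi => f (restr I phi))| <= C / N%:R.
Proof.
move=> mm' m'rho sf; have mrho := lt_trans mm' m'rho.
have [G [C1 [N1 H1]]] := mc_avg_gaussian mrho sf.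
have [G' [C2 [N2 H2]]] := mc_avg_gaussian m'rho sf.
pose a := Num.sqrt (rho - m ^+ 2); pose b := Num.sqrt (rho - m' ^+ 2).
have a0 : 0 < a by rewrite sqrtr_gt0 subr_gt0.
have b0 : 0 < b by rewrite sqrtr_gt0 subr_gt0.
have ba : b < a by rewrite ltr_sqrt ?subr_gt0 // ltrD2l ltrN2.
have [C [C0 HC]] : exists C : R, 0 <= C /\ forall N, (4 <= N)%N -> (b / a) ^+ (N - 3) <= C / N%:R.
  by apply: pow_le_inv; rewrite divr_ge0 ?ltW //= ltr_pdivrMr // mul1r.
exists (C1 + C * (`|G'| + `|C2| + `|G|)), (N1 + N2 + 4)%N => N I NN injI.
have N4 : (4 <= N)%N by clear -NN; lia.
have N3 : (3 <= N)%N by exact: ltnW.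
have N0 : 0 < N%:R :> R by rewrite ltr0n (leq_trans _ N4).
have N1N : (N1 <= N)%N by clear -NN; lia.
have N2N : (N2 <= N)%N by clear -NN; lia.
have [-> h1] := H1 N I N1N injI.
have [_ h2] := H2 N I N2N injI.
rewrite !Z_MC_sqrt //; rewrite -/a -/b.
set A1 := mc_avg m rho N _ in h1 *; set A2 := mc_avg m' rho N _ in h2 *.
have hA2 : `|A2| <= `|G'| + `|C2|.
  have -> : A2 = G' + (A2 - G') by ring.
  rewrite (le_trans (ler_normD _ _)) // lerD2l (le_trans h2) //.
  by rewrite ler_pdivrMr // (le_trans (ler_norm _)) // ler_peMr // ler1n (leq_trans _ N4).
rewrite [(C1 + _) / _]mulrDl [C * _ / _]mulrAC; apply: weighted_close => //.
- by rewrite exprn_gt0.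
- by rewrite exprn_ge0 // ltW.
- apply: le_trans (ler_wpM2l _ (HC N N4)); last by rewrite exprn_ge0 // ltW.
  by rewrite -exprMn mulrC mulfVK // lt0r_neq0.
- by rewrite divr_ge0 // ltW.
Qed.

End FixedEnergy.

Theorem theorem4p29 (R : realType) (J h rho eps : R) (k : nat)
    (f : ('I_k -> R) -> R) :
  0 < J -> h != 0 -> 0 < rho -> admissible_energy J h rho eps ->
  (bounded_1lipschitz f \/ coord_monomial f) ->
  let m := - (h / J) + Num.sg h * Num.sqrt (h ^+ 2 / J ^+ 2 - 2 * eps / J) in
  let mu := - (m / (rho - m ^+ 2)) in
  let eta := (2 * (rho - m ^+ 2))^-1 in
  exists C : R, exists N0 : nat, forall (N : nat) (I : 'I_k -> 'I_N),
    (N0 <= N)%N -> injective I ->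
    `| fe_avg J h eps rho N (fun phi => f (restr I phi))
       - gc_avg mu eta N (fun phi => f (restr I phi)) |
      <= C / Num.sqrt (N%:R).
Proof.
move=> J0 hn0 rho0 [epsle adm] fclass m mu eta.
have sf : subgauss k (on_seq f).
  by case: fclass; [exact: subgauss_lipschitz|exact: subgauss_monomial].
set s := Num.sqrt _ in adm m mu eta *.
have s0 : 0 <= s by exact: sqrtr_ge0.
have hJ : h / J = Num.sg h * (`|h| / J) by rewrite mulrA -numEsg.
have sgh2 : Num.sg h ^+ 2 = 1 by rewrite sqr_sg hn0.
have mrho : m ^+ 2 < rho.
  (* Up to sign [m] is [|h| / J - s], so [m^2 < rho] is exactly the second admissibility
     condition. *)
  have -> : m = - (Num.sg h * (`|h| / J - s)) by rewrite /m hJ; ring.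
  rewrite sqrrN exprMn sgh2 mul1r -(real_normK (num_real _)) -[ltRHS]sqr_sqrtr ?ltW //.
  by rewrite ltrXn2r ?nnegrE ?sqrtr_ge0.
suff [C [N0 H]] : exists C : R, exists N0 : nat, forall (N : nat) (I : 'I_k -> 'I_N),
    (N0 <= N)%N -> injective I ->
    `| fe_avg J h eps rho N (fun phi => f (restr I phi))
       - gc_avg mu eta N (fun phi => f (restr I phi)) | <= C / N%:R.
  exists `|C|, N0.+1 => N I NN injI.
  by apply: (le_trans (H N I (ltnW NN) injI)); apply: le_inv_sqrt; exact: leq_ltn_trans NN.
have [G [C1 [N1 H1]]] := mc_avg_gaussian mrho sf.
have close_m : forall N (I : 'I_k -> 'I_N), (N1 <= N)%N -> injective I ->
    `|mc_avg m rho N (fun phi => f (restr I phi))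
      - gc_avg mu eta N (fun phi => f (restr I phi))| <= C1 / N%:R.
  by move=> N I NN injI; have [-> ?] := H1 N I NN injI.
have [epslt|epsge] := ltP eps (h ^+ 2 / (2 * J)); last first.
  exists C1, N1 => N I NN injI; rewrite /fe_avg ltNge epsge /=.
  suff -> : - (h / J) = m by exact: close_m.
  (* At the maximal energy the discriminant vanishes and both roots collapse to [- h / J]. *)
  rewrite /m (_ : s = 0) ?mulr0 ?addr0 // /s; apply/eqP; rewrite sqrtr_eq0.
  rewrite le_eqVlt (_ : eps = h ^+ 2 / (2 * J)); last by apply/eqP; rewrite eq_le epsle.
  by apply/orP; left; apply/eqP; field; exact: lt0r_neq0.
have sp : 0 < s.
  rewrite sqrtr_gt0 subr_gt0 -(ltr_pM2r (_ : 0 < J / 2)) ?divr_gt0 //.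
  have -> : 2 * eps / J * (J / 2) = eps by field; exact: lt0r_neq0.
  have -> : h ^+ 2 / J ^+ 2 * (J / 2) = h ^+ 2 / (2 * J) by field; exact: lt0r_neq0.
  by [].
have a0 : 0 < `|h| / J by rewrite divr_gt0 // normr_gt0.
(* The squares differ by [4 (|h| / J) s], positive because [h] and [s] are nonzero: [m] has strictly
   smaller modulus than the other root. *)
have sqlt : (`|h| / J - s) ^+ 2 < (`|h| / J + s) ^+ 2.
  rewrite -subr_gt0 (_ : _ - _ = 4 * (`|h| / J * s)); last by ring.
  by rewrite mulr_gt0 // mulr_gt0.
have norm_lt (x x' : R) : x ^+ 2 < x' ^+ 2 -> `|x| < `|x'|.
  by move=> xx'; rewrite -(@ltr_pXn2r _ 2) ?nnegrE // !real_normK ?num_real.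
(* The sign of [h] decides which of the two roots is [m]. *)
have [[mE sq]|[mE sq]] :
    (m_plus J h eps = m /\ m_plus J h eps ^+ 2 < m_minus J h eps ^+ 2) \/
    (m_minus J h eps = m /\ m_minus J h eps ^+ 2 < m_plus J h eps ^+ 2).
- rewrite /m_plus /m_minus -/s; have [h0|h0] := ltP 0 h.
    left; split; first by rewrite /m gtr0_sg // mul1r.
    move: sqlt; rewrite gtr0_norm // -(sqrrN (h / J - s)) -(sqrrN (h / J + s)).
    by rewrite opprB opprD addrC.
  have {}h0 : h < 0 by rewrite lt_neqAle hn0.
  right; split; first by rewrite /m ltr0_sg // mulN1r.
  by move: sqlt; rewrite ltr0_norm // mulNr.
(* Either the other root is allowed too and carries a negligible weight, or the ensemble selects the
   root of smaller modulus, which is [m]. *)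
- have [mm|mm] := ltP (m_minus J h eps ^+ 2) rho.
    rewrite mE in sq; have [C [N0 HC]] := two_branches_close sq mm sf.
    exists C, N0 => N I NN injI; rewrite /fe_avg epslt mE mrho mm /=.
    exact: HC.
  exists C1, N1 => N I NN injI; rewrite /fe_avg epslt [X in _ && X]ltNge mm andbF.
  by rewrite (norm_lt _ _ sq) mE; exact: close_m.
- have [mm|mm] := ltP (m_plus J h eps ^+ 2) rho.
    rewrite mE in sq; have [C [N0 HC]] := two_branches_close sq mm sf.
    exists C, N0 => N I NN injI; rewrite /fe_avg epslt mE mrho mm /=.
    by rewrite [X in X / _]addrC [X in _ / X]addrC; exact: HC.
  exists C1, N1 => N I NN injI; rewrite /fe_avg epslt [X in X && _]ltNge mm /=.
  by rewrite ltNge (ltW (norm_lt _ _ sq)) /= mE; exact: close_m.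
Qed.
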